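(* Let $n,p\ge1$ and use the fixed-design multi-resolution notation of the context: matrices $U_{j,k}\in\mathbb R^{n\times d_{j,k}}$, $(j,k)\in\mathscr K^*$, penalty levels $\lambda_{j,k}>0$, a constant $A_0>1$, and the MR-GL estimator $\hat f=\sum_{(j,k)\in\mathscr K^*}U_{j,k}\hat\beta_{j,k}\in\mathbb R^n$ computed from $y\in\mathbb R^n$. Let $\xi=(A_0+1)/(A_0-1)$. (i) Let $f^*\in\mathbb R^n$ be any vector with $$\|P_{j,k}(y-f^* )\|_{2,n}\le\lambda_{j,k}\quad\text{for all }(j,k)\in\mathscr K^*,\qquad (\ast)$$ where $P_{j,k}$ is the orthogonal projection of $\mathbb R^n$ onto the column space of $U_{j,k}$. Let $\bar\beta=(\bar\beta_{j,k}^\top,(j,k)\in\mathscr K^* )^\top$ with $\bar\beta_{j,k}\in\mathbb R^{d_{j,k}}$ be any coefficient vector, $\bar f_{j,k}=U_{j,k}\bar\beta_{j,k}$, $\bar f=\sum_{(j,k)\in\mathscr K^*}\bar f_{j,k}$, and let $S\subset\mathscr K^*$. Then $$\|\hat f-f^*\|_{2,n}^2\le B_S+\bar\Delta_S,\qquad \|\hat f-\bar f\|_{2,n}^2+\|\hat f-f^*\|_{2,n}^2\le 4B_S+2\bar\Delta_S,$$ where $\bar\Delta_S=\|\bar f-f^*\|_{2,n}^2+4A_0\,\mathrm{pen}_{S^c}(\bar\beta)$, $S^c=\mathscr K^*\setminus S$, and $B_S=(A_0+1)^2C_{\rm pred}(\xi,S)\sum_{(j,k)\in S}\lambda_{j,k}^2$.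 In particular, for $S=\{(j,k)\in\mathscr K^*:\|\bar f_{j,k}\|_{2,n}\ge A_0\lambda_{j,k}\}$, $$\|\hat f-\bar f\|_{2,n}^2+\|\hat f-f^*\|_{2,n}^2\le 2\|\bar f-f^*\|_{2,n}^2+C^*_{\rm pred}(\xi,S)\sum_{(j,k)\in\mathscr K^*}\min\big(\lambda_{j,k}^2,\ \lambda_{j,k}\|\bar f_{j,k}\|_{2,n}\big),$$ with $C^*_{\rm pred}(\xi,S)=\max\{8A_0^2,\,4(A_0+1)^2C_{\rm pred}(\xi,S)\}$. (ii) Suppose $y-f^*$ has i.i.d. $N(0,\sigma^2)$ entries, $0<\epsilon\le1\le 2\log(p/\epsilon)$, and $$\lambda_{j,k}=\begin{cases}\sigma\big((d_j^*/n)^{1/2}+\sqrt{(2/n)\log(p/\epsilon)}\big),& j\in J_0,\\ \sigma\big((2^k/n)^{1/2}+\sqrt{(2/n)\log(p/\epsilon)}\big),& j\in J_1.\end{cases}$$ Then $(\ast)$ holds with probability at least $1-\epsilon/\sqrt{2\log(p/\epsilon)}$.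
   Context: $\|u\|_{2,n}=\|u\|_2/\sqrt n$ for $u\in\mathbb R^n$. The index set $\{1,\dots,p\}$ is the disjoint union of $J_0$ (parametric components) and $J_1$ (nonparametric components). Integers $0\le k_*\le k^*$ are given and $$\mathscr K^*=\{(j,k_* ):j\in J_0\}\cup\{(j,k):j\in J_1,\ k_*\le k\le k^*\}.$$ Group sizes: $d_{j,k_*}=d_j^*$ (a given positive integer) for $j\in J_0$, and $d_{j,k}=2^{\max(k-1,k_* )}$ for $j\in J_1$. $U_{j,k}\in\mathbb R^{n\times d_{j,k}}$ is a deterministic matrix (its columns are basis functions evaluated at the $j$-th design vector). MR-GL estimator: $\hat\beta=(\hat\beta_{j,k}^\top,(j,k)\in\mathscr K^* )^\top$ is any minimizer over $b=(b_{j,k}^\top,(j,k)\in\mathscr K^* )^\top$, $b_{j,k}\in\mathbb R^{d_{j,k}}$, of $$\frac12\Big\|y-\sum_{(j,k)\in\mathscr K^*}U_{j,k}b_{j,k}\Big\|_{2,n}^2+A_0\sum_{(j,k)\in\mathscr K^*}\lambda_{j,k}\|U_{j,k}b_{j,k}\|_{2,n},$$ and $\hat f=\sum_{(j,k)\in\mathscr K^*}U_{j,k}\hat\beta_{j,k}$. For $S\subset\mathscr K^*$: $\mathrm{pen}_S(b)=\sum_{(j,k)\in S}\lambda_{j,k}\|U_{j,k}b_{j,k}\|_{2,n}$. For $\xi\ge1$, the prediction factor is $$C_{\rm pred}(\xi,S)=\sup_b\frac{\{\mathrm{pen}_S(b)-\xi^{-1}\mathrm{pen}_{S^c}(b)\}_+^2}{\big(\sum_{(j,k)\in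 S}\lambda_{j,k}^2\big)\,\big\|\sum_{(j,k)\in\mathscr K^*}U_{j,k}b_{j,k}\big\|_{2,n}^2},\qquad S^c=\mathscr K^*\setminus S,$$ with the convention $0/0=0$ (the value $+\infty$ is allowed). *)

(* Defs.v *)
From HB Require Import structures.
From mathcomp Require Import all_boot all_order all_algebra.
From mathcomp Require Import all_classical all_reals all_analysis.

Set Implicit Arguments.
Unset Strict Implicit.
Unset Printing Implicit Defensive.

Import Order.TTheory GRing.Theory Num.Theory.

Local Open Scope classical_set_scope.
Local Open Scope ring_scope.

Section Norms.
Context {R : realType}.

Definition norm2 n (u : 'cV[R]_n) : R := Num.sqrt (\sum_i u i 0 ^+ 2).

Definition norm2n n (u : 'cV[R]_n) : R := norm2 u / Num.sqrt n%:R.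

(* [mxalgebra] works with row spaces: the row space of [U^T] is the column
   space of [U], and that of [kermx U] is its orthogonal complement.  The outer
   transpose makes the projection act on column vectors. *)
Definition orthoproj n m (U : 'M[R]_(n, m)) : 'M[R]_n :=
  (proj_mx <<U^T>>%MS (kermx U))^T.

Lemma tr_addsmx_kermx n m (U : 'M[R]_(n, m)) : row_full (<<U^T>> + kermx U)%MS.
Proof.
have h0 : (<<U^T>> :&: kermx U)%MS = 0.
  apply/eqP/rowV0P => w; rewrite sub_capmx genmxE => /andP[/submxP[a ->]].
  move=> /sub_kermxP h.
  have : (a *m U^T) *m (a *m U^T)^T = 0.
    by rewrite trmx_mul trmxK mulmxA h mul0mx.
  move: (a *m U^T) => w' /matrixP /(_ 0 0); rewrite !mxE => /eqP.
  rewrite psumr_eq0 => [/allP hw|i _]; last by rewrite mxE -expr2 sqr_ge0.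
  apply/rowP => i; have := hw i (mem_index_enum i).
  by rewrite !mxE -expr2 sqrf_eq0 => /eqP.
rewrite /row_full mxrank_disjoint_sum // mxrank_gen mxrank_tr mxrank_ker.
by rewrite subnKC // rank_leq_row.
Qed.

(* [orthoproj U *m v] is the unique vector of the column space of [U] whose
   difference with [v] is orthogonal to all the columns of [U]. *)
Lemma orthoprojP n m (U : 'M[R]_(n, m)) (v : 'cV[R]_n) :
  (exists b : 'cV[R]_m, orthoproj U *m v = U *m b) /\
  U^T *m (v - orthoproj U *m v) = 0.
Proof.
pose q := proj_mx <<U^T>>%MS (kermx U).
have qE : orthoproj U *m v = (v^T *m q)^T by rewrite trmx_mul trmxK.
split.
  have := proj_mx_sub <<U^T>>%MS (kermx U) v^T.
  rewrite genmxE -/q => /submxP[a ha]; exists a^T.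
  by rewrite qE ha trmx_mul trmxK.
have : (v^T <= <<U^T>> + kermx U)%MS by apply/submx_full/tr_addsmx_kermx.
move=> /proj_mx_compl_sub /sub_kermxP h.
by rewrite qE -[v - _]trmxK raddfB /= trmxK -trmx_mul h trmx0.
Qed.

End Norms.

Section GroupLasso.
Context {R : realType} {n : nat} {I : finType} {d : I -> nat}.
Variables (U : forall i, 'M[R]_(n, d i)) (lam : I -> R).

Definition fit (b : forall i, 'cV[R]_(d i)) : 'cV[R]_n := \sum_i U i *m b i.

Definition pen (S : {set I}) (b : forall i, 'cV[R]_(d i)) : R :=
  \sum_(i in S) lam i * norm2n (U i *m b i).

Definition gl_objective (A0 : R) (y : 'cV[R]_n) (b : forall i, 'cV[R]_(d i)) : R :=
  2^-1 * norm2n (y - fit b) ^+ 2 + A0 * \sum_i lam i * norm2n (U i *m b i).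

Definition is_gl_estimator (A0 : R) (y : 'cV[R]_n)
    (betahat : forall i, 'cV[R]_(d i)) : Prop :=
  forall b, gl_objective A0 y betahat <= gl_objective A0 y b.

(* Division in [\bar R] is such that 0 / 0 = 0 and x / 0 = +oo for x > 0. *)
Definition Cpred (xi : R) (S : {set I}) : \bar R :=
  ereal_sup (range (fun b : forall i, 'cV[R]_(d i) =>
    ((Num.max (pen S b - xi^-1 * pen (~: S) b) 0 ^+ 2)%:E /
     ((\sum_(i in S) lam i ^+ 2) * norm2n (fit b) ^+ 2)%:E)%E)).

Definition Cpred_star (A0 xi : R) (S : {set I}) : \bar R :=
  Order.max (8 * A0 ^+ 2)%:E ((4 * (A0 + 1) ^+ 2)%:E * Cpred xi S)%E.

Definition bound_B (A0 xi : R) (S : {set I}) : \bar R :=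
  (((A0 + 1) ^+ 2)%:E * Cpred xi S * (\sum_(i in S) lam i ^+ 2)%:E)%E.

Definition bound_Delta (A0 : R) (fstar : 'cV[R]_n) (S : {set I})
    (b : forall i, 'cV[R]_(d i)) : R :=
  norm2n (fit b - fstar) ^+ 2 + 4 * A0 * pen (~: S) b.

Definition noise_controlled (y fstar : 'cV[R]_n) : Prop :=
  forall i, norm2n (orthoproj (U i) *m (y - fstar)) <= lam i.

End GroupLasso.

Section MultiResolution.
Context {p : nat}.
Variables (J0 J1 : {set 'I_p}) (kmin kmax : nat).

Definition Kstar : {set 'I_p * 'I_kmax.+1} :=
  [set jk : 'I_p * 'I_kmax.+1 |
     ((jk.1 \in J0) && (jk.2 == kmin :> nat))
  || ((jk.1 \in J1) && (kmin <= jk.2 <= kmax)%N)]%SET.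

Definition grp : finType := {jk : 'I_p * 'I_kmax.+1 | jk \in Kstar}.

Definition gcomp (g : grp) : 'I_p := (val g).1.
Definition glevel (g : grp) : nat := (val g).2.

Definition gsize (dstar : 'I_p -> nat) (g : grp) : nat :=
  if gcomp g \in J0 then dstar (gcomp g) else (2 ^ maxn (glevel g - 1) kmin)%N.

Definition lambda_univ {R : realType} (n : nat) (dstar : 'I_p -> nat)
    (sigma eps : R) (g : grp) : R :=
  sigma * (Num.sqrt ((if gcomp g \in J0 then dstar (gcomp g)
                      else 2 ^ glevel g)%N%:R / n%:R)
           + Num.sqrt (2 / n%:R * ln (p%:R / eps))).

End MultiResolution.

Section IidNormal.
Context {d : measure_display} {T : measurableType d} {R : realType}.
Variable P : probability T R.

Definition mutually_independent (I : finType) (X : I -> {RV P >-> R}) : Prop :=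
  forall (J : {set I}) (B : I -> set R),
    (forall i, i \in J -> measurable (B i)) ->
    P (\bigcap_(i in [set` J]) (X i @^-1` B i)) =
    (\prod_(i in J) P (X i @^-1` B i))%E.

Definition iid_normal (I : finType) (m s : R) (X : I -> {RV P >-> R}) : Prop :=
  mutually_independent X /\
  forall i (B : set R), measurable B -> distribution P (X i) B = normal_prob m s B.

End IidNormal.

(* Main.v *)
Require Import Defs.
From mathcomp Require Import all_boot all_order all_algebra.
From mathcomp Require Import all_classical all_reals all_analysis.
From mathcomp Require Import measurable_realfun ring lra.

Set Implicit Arguments.
Unset Strict Implicit.
Unset Printing Implicit Defensive.

Import Order.TTheory GRing.Theory Num.Theory.

Local Open Scope ring_scope.

(* Part (i): comparing the estimator with points of the segment towards
   [betabar] gives the basic inequality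
     |fhat - fbar|^2 + |fhat - f*|^2
       <= Delta_S + 2 (A0 + 1) {pen_S(h) - xi^-1 pen_{S^c}(h)},   h = betahat - betabar,
   and the braces are bounded through the prediction factor.

   Part (ii): the union bound has to give [eps / t], t = sqrt (2 log (p / eps)),
   although each component j carries a whole range of levels, so the tail of
   W = |P_{j,k} Z|^2 (Z standard Gaussian) is needed with a good constant.  The
   moment generating function of W is computed by Hubbard-Stratonovich from
   exponentials of linear forms of Z.  Markov's inequality with the limiting test
   function W e^{sW/2} then gives a bound smaller than Chernoff's
   (x / sqrt m)^m e^{(m - x^2) / 2} by the factor [kappa m].  The threshold is
   x = sqrt m + t for the first level of a component and x = sqrt (2 m) + t for
   the next ones, m = 2^j being the group size; multiplied by t e^{t^2 / 2} the
   bounds are at most [near_bound j] and [far_bound j], whose sum over the levels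
   of one component is at most 1. *)

(** * Oracle inequalities *)

Section Dot.
Context {R : realType} {n : nat}.
Implicit Types u v w : 'cV[R]_n.

Definition dot u v : R := \sum_i u i 0 * v i 0.

Lemma dotC u v : dot u v = dot v u.
Proof. by apply: eq_bigr => i _; rewrite mulrC. Qed.

Lemma dotDl u v w : dot (u + v) w = dot u w + dot v w.
Proof. by rewrite -big_split; apply: eq_bigr => i _; rewrite mxE mulrDl. Qed.

Lemma dotZl a u v : dot (a *: u) v = a * dot u v.
Proof. by rewrite mulr_sumr; apply: eq_bigr => i _; rewrite mxE mulrA. Qed.

Lemma dotNl u v : dot (- u) v = - dot u v.
Proof. by rewrite -scaleN1r dotZl mulN1r. Qed.

Lemma dotBl u v w : dot (u - v) w = dot u w - dot v w.
Proof. by rewrite dotDl dotNl. Qed.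

Lemma dotDr u v w : dot w (u + v) = dot w u + dot w v.
Proof. by rewrite dotC dotDl !(dotC w). Qed.

Lemma dotZr a u v : dot u (a *: v) = a * dot u v.
Proof. by rewrite dotC dotZl dotC. Qed.

Lemma dotBr u v w : dot w (u - v) = dot w u - dot w v.
Proof. by rewrite dotC dotBl !(dotC w). Qed.

Lemma dot0l v : dot 0 v = 0.
Proof. by rewrite -(scale0r v) dotZl mul0r. Qed.

Lemma dot_suml (J : Type) (r : seq J) (F : J -> 'cV[R]_n) v :
  dot (\sum_(j <- r) F j) v = \sum_(j <- r) dot (F j) v.
Proof. by apply: (big_morph (dot^~ v)) => [u w|]; rewrite ?dotDl ?dot0l. Qed.

Lemma dot_sumr (J : Type) (r : seq J) (F : J -> 'cV[R]_n) v :
  dot v (\sum_(j <- r) F j) = \sum_(j <- r) dot v (F j).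
Proof. by rewrite dotC dot_suml; apply: eq_bigr => j _; rewrite dotC. Qed.

Lemma dot_ge0 u : 0 <= dot u u.
Proof. by apply: sumr_ge0 => i _; rewrite -expr2 sqr_ge0. Qed.

Lemma dot_eq0 u : dot u u = 0 -> u = 0.
Proof.
move/eqP; rewrite psumr_eq0 => [/allP u0|i _]; last by rewrite -expr2 sqr_ge0.
apply/colP => i; have := u0 i (mem_index_enum i).
by rewrite mxE -expr2 sqrf_eq0 => /eqP.
Qed.

Lemma dotE u v : dot u v = (u^T *m v) 0 0.
Proof. by rewrite mxE; apply: eq_bigr => i _; rewrite mxE. Qed.

Lemma norm2n_sqr u : norm2n u ^+ 2 = dot u u / n%:R.
Proof.
rewrite /norm2n /norm2 exprMn exprVn !sqr_sqrtr ?ler0n //.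
by apply: sumr_ge0 => i _; rewrite sqr_ge0.
Qed.

Lemma norm2n_ge0 u : 0 <= norm2n u.
Proof. by rewrite divr_ge0 ?sqrtr_ge0. Qed.

Lemma norm2nZ a u : norm2n (a *: u) = `|a| * norm2n u.
Proof.
rewrite /norm2n mulrA; congr (_ / _); rewrite /norm2 -sqrtr_sqr -sqrtrM ?sqr_ge0 //.
by rewrite mulr_sumr; congr Num.sqrt; apply: eq_bigr => i _; rewrite mxE exprMn.
Qed.

Lemma norm2nN u : norm2n (- u) = norm2n u.
Proof. by rewrite -scaleN1r norm2nZ normrN1 mul1r. Qed.

Lemma norm2n0 : norm2n (0 : 'cV[R]_n) = 0.
Proof. by rewrite -(scale0r 0) norm2nZ normr0 mul0r. Qed.

Lemma norm2nB_sqr u v :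
  norm2n (u - v) ^+ 2 = norm2n u ^+ 2 - 2 * (dot u v / n%:R) + norm2n v ^+ 2.
Proof. by rewrite !norm2n_sqr !dotBl !dotBr (dotC v u); ring. Qed.

(** Cauchy-Schwarz, from the square of [norm2n v *: u - norm2n u *: v]. If the product of the norms
    vanishes, then a vector is zero or [n] is 0, and in the latter case dividing by [n%:R] gives
    0. *)
Lemma dot_norm2n u v : dot u v / n%:R <= norm2n u * norm2n v.
Proof.
case: (ltP 0 (norm2n u * norm2n v)) => [uv_gt0|uv_le0].
  have := sqr_ge0 (norm2n (norm2n v *: u - norm2n u *: v)).
  rewrite norm2nB_sqr !norm2nZ !ger0_norm ?norm2n_ge0 // dotZl dotZr => h.
  rewrite -(ler_pM2l uv_gt0).
  have -> : norm2n u * norm2n v * (dot u v / n%:R) =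
     norm2n v * (norm2n u * dot u v) / n%:R by ring.
  lra.
have cauchy w w' : norm2n w = 0 -> dot w w' / n%:R = 0.
  move=> w0; have : norm2n w ^+ 2 = 0 by rewrite w0 expr0n.
  rewrite norm2n_sqr => /eqP; rewrite mulf_eq0 => /orP[/eqP/dot_eq0->|/eqP->].
    by rewrite dot0l mul0r.
  by rewrite mulr0.
have /eqP : norm2n u * norm2n v = 0.
  by apply: le_anti; rewrite uv_le0 mulr_ge0 ?norm2n_ge0.
by rewrite mulf_eq0 => /orP[]/eqP e0; rewrite e0 ?mulr0 ?mul0r; last rewrite dotC;
   rewrite cauchy.
Qed.

Lemma ler_norm2nD u v : norm2n (u + v) <= norm2n u + norm2n v.
Proof.
rewrite -(@ler_pXn2r _ 2) ?nnegrE ?addr_ge0 ?norm2n_ge0 //.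
have -> : u + v = u - (- v) by rewrite opprK.
rewrite norm2nB_sqr norm2nN dotC dotNl dotC.
have := dot_norm2n u v; lra.
Qed.

End Dot.

(** Replaces a passage to the limit [t -> 0]: if [a] were positive, so would be [b], and
    [t = a / (a + b)] would contradict the bound. *)
Lemma le0_of_small (R : realFieldType) (a b : R) :
  (forall t, 0 < t -> t <= 1 -> a <= t * b) -> a <= 0.
Proof.
move=> h; rewrite leNgt; apply/negP => a_gt0.
have b_gt0 : 0 < b by have := h 1; lra.
have := h (a / (a + b)); rewrite divr_gt0 ?ler_pdivrMr ?mul1r; [|lra|lra|lra].
move=> /(_ isT) /(_ ltac:(lra)).
rewrite mulrAC ler_pdivlMr; last lra.
by rewrite mulrDr gerDr leNgt mulr_gt0.
Qed.

(** * Deterministic analysis of the group Lasso *)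

Section GroupLassoOracle.
Context {R : realType} {n : nat} {I : finType} {d : I -> nat}.
Variables (U : forall i, 'M[R]_(n, d i)) (lam : I -> R).
Hypothesis lam_gt0 : forall i, 0 < lam i.
Implicit Types (b : forall i, 'cV[R]_(d i)) (S : {set I}).

Lemma fitB b c : fit U (fun i => b i - c i) = fit U b - fit U c.
Proof. by rewrite /fit -sumrB; apply: eq_bigr => i _; rewrite mulmxBr. Qed.

Lemma pen_ge0 S b : 0 <= pen U lam S b.
Proof. by apply: sumr_ge0 => i _; rewrite mulr_ge0 ?norm2n_ge0 ?ltW. Qed.

Lemma pen_setC S b :
  \sum_i lam i * norm2n (U i *m b i) = pen U lam S b + pen U lam (~: S) b.
Proof.
rewrite (bigID (mem S)) /=; congr (_ + _).
by apply: eq_bigl => i; rewrite inE.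
Qed.

Lemma penB_le S b c :
  pen U lam S b - pen U lam S c <= pen U lam S (fun i => b i - c i).
Proof.
rewrite /pen -sumrB ler_sum // => i _; rewrite -mulrBr ler_pM2l // lerBlDr.
rewrite -{1}[b i](subrK (c i)) mulmxDr; exact: ler_norm2nD.
Qed.

Lemma penB_le_add S b c :
  pen U lam S (fun i => b i - c i) <= pen U lam S b + pen U lam S c.
Proof.
rewrite /pen -big_split ler_sum //= => i _; rewrite -mulrDr ler_pM2l //.
by rewrite mulmxBr -[norm2n (U i *m c i)]norm2nN ler_norm2nD.
Qed.

Lemma dot_orthoproj m (A : 'M[R]_(n, m)) v c :
  dot (orthoproj A *m v) (A *m c) = dot v (A *m c).
Proof.
have [_ h] := orthoprojP A v; apply/esym/eqP; rewrite -subr_eq0 -dotBl dotC dotE.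
by rewrite trmx_mul -mulmxA h mulmx0 mxE.
Qed.

(** Each [U i *m b i] lies in the column space of [U i], so the noise may be projected onto it
    before Cauchy-Schwarz is applied. *)
Lemma noise_dot_le y fstar b : noise_controlled U lam y fstar ->
  dot (y - fstar) (fit U b) / n%:R <= \sum_i lam i * norm2n (U i *m b i).
Proof.
move=> ctrl; rewrite dot_sumr mulr_suml ler_sum // => i _.
rewrite -dot_orthoproj (le_trans (dot_norm2n _ _)) //.
by rewrite ler_wpM2r ?norm2n_ge0 // ctrl.
Qed.

(* First-order optimality, obtained by moving from [bh] towards [b]. *)
Lemma gl_estimator_dot A0 y bh b : 0 <= A0 -> is_gl_estimator U lam A0 y bh ->
  dot (y - fit U bh) (fit U b - fit U bh) / n%:R <=
  A0 * (\sum_i lam i * norm2n (U i *m b i) - \sum_i lam i * norm2n (U i *m bh i)).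
Proof.
move=> A0_ge0 bh_min; rewrite -subr_le0.
(* At [bh + t (b - bh)] the penalty is bounded by convexity, and after division by [t] the quadratic
   loss leaves only this remainder, of order [t]. *)
apply: (@le0_of_small _ _ (norm2n (fit U b - fit U bh) ^+ 2 / 2)) => t t0 t1.
have := bh_min (fun i => (1 - t) *: bh i + t *: b i); rewrite /gl_objective.
have -> : fit U (fun i => (1 - t) *: bh i + t *: b i) =
    fit U bh + t *: (fit U b - fit U bh).
  rewrite /fit -sumrB scaler_sumr -big_split; apply: eq_bigr => i _ /=.
  by rewrite mulmxDr -!scalemxAr scalerBl scale1r scalerBr addrAC addrA.
set p := \sum_i lam i * norm2n (U i *m b i).
set ph := \sum_i lam i * norm2n (U i *m bh i).
have : \sum_i lam i * norm2n (U i *m ((1 - t) *: bh i + t *: b i)) <=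
    (1 - t) * ph + t * p.
  rewrite /p /ph !mulr_sumr -big_split ler_sum //= => i _.
  rewrite mulmxDr -!scalemxAr.
  have := ler_norm2nD ((1 - t) *: (U i *m bh i)) (t *: (U i *m b i)).
  rewrite !norm2nZ !ger0_norm ?subr_ge0 ?(ltW t0) // => h.
  by rewrite !(mulrCA _ (lam i)) -mulrDr ler_pM2l.
move: (\sum_i _) => q hq.
rewrite opprD addrA; move: (y - fit U bh) (fit U b - fit U bh) => v w.
rewrite (norm2nB_sqr v) norm2nZ dotZr (gtr0_norm t0) [(t * _) ^+ 2]exprMn.
set g := norm2n v ^+ 2; set r := norm2n w ^+ 2; set z := dot v w => h.
have {}hq : A0 * q <= A0 * ((1 - t) * ph + t * p) by rewrite ler_wpM2l.
rewrite -(ler_pM2l t0).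
rewrite -mulrA in h; move: p ph r g (z / n%:R) h hq => {bh_min z} p ph r g z h hq.
clear - h hq; lra.
Qed.

Lemma gl_basic_inequality A0 y bh fstar b S :
  1 < A0 -> is_gl_estimator U lam A0 y bh -> noise_controlled U lam y fstar ->
  norm2n (fit U bh - fit U b) ^+ 2 + norm2n (fit U bh - fstar) ^+ 2 <=
  bound_Delta U lam A0 fstar S b +
  2 * (A0 + 1) * (pen U lam S (fun i => bh i - b i) -
     ((A0 + 1) / (A0 - 1))^-1 * pen U lam (~: S) (fun i => bh i - b i)).
Proof.
move=> A0_gt1 bh_min ctrl.
have opt := gl_estimator_dot b (ltW (lt_trans ltr01 A0_gt1)) bh_min.
have := noise_dot_le (fun i => bh i - b i) ctrl.
have S_le := penB_le S b bh.
have Sc_le := penB_le_add (~: S) bh b.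
have S_sym : pen U lam S (fun i => b i - bh i) = pen U lam S (fun i => bh i - b i).
  by apply: eq_bigr => i _; rewrite -opprB mulmxN norm2nN.
rewrite !(pen_setC S) in opt *; rewrite fitB S_sym in S_le * => noise.
have -> : norm2n (fit U bh - fit U b) ^+ 2 = norm2n (fit U b - fit U bh) ^+ 2.
  by rewrite -opprB norm2nN.
have e : norm2n (fit U b - fstar) ^+ 2 = norm2n (fit U bh - fstar) ^+ 2
    + 2 * (dot (fit U bh - fstar) (fit U b - fit U bh) / n%:R)
    + norm2n (fit U b - fit U bh) ^+ 2.
  have -> : fit U b - fstar = (fit U bh - fstar) - (fit U bh - fit U b).
    by apply/colP => i; rewrite !mxE; ring.
  rewrite norm2nB_sqr -[fit U bh - fit U b]opprB norm2nN [dot _ (- _)]dotC dotNl.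
  by rewrite dotC; ring.
have e2 : dot (fit U bh - fstar) (fit U b - fit U bh) =
    - dot (y - fit U bh) (fit U b - fit U bh) - dot (y - fstar) (fit U bh - fit U b).
  by rewrite !dotBl !dotBr; ring.
rewrite e2 mulrBl mulNr in e.
rewrite /bound_Delta invf_div.
set q := (A0 - 1) / (A0 + 1).
have qE : q * (A0 + 1) = A0 - 1 by rewrite divfK // gt_eqF; lra.
rewrite mulrBr [2 * _ * (q * _)]mulrCA mulrA.
have -> : q * (2 * (A0 + 1)) = 2 * (A0 - 1) by rewrite mulrCA qE.
have A0_ge0 : 0 <= A0 by lra.
have {}S_le := ler_wpM2l A0_ge0 S_le.
have {}Sc_le := ler_wpM2l A0_ge0 Sc_le.
clear - opt S_le Sc_le noise e; lra.
Qed.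

Local Open Scope ereal_scope.

Lemma Cpred_ge0 xi S : 0 <= Cpred U lam xi S.
Proof.
apply: ereal_sup_ubound; exists (fun=> 0%R) => //=.
have pen0 S' : pen U lam S' (fun=> 0%R) = 0%R.
  by apply: big1 => i _; rewrite mulmx0 norm2n0 mulr0.
by rewrite !pen0 mulr0 subrr maxxx expr0n mul0e.
Qed.

(** The numerator is the positive part of a nonpositive number. Hence an infinite prediction factor
    forces [S] to be nonempty, which rules out products of [+oo] and 0 below. *)
Lemma Cpred_set0 xi : (0 <= xi)%R -> Cpred U lam xi finset.set0 = 0.
Proof.
move=> xi_ge0; apply: le_anti; rewrite Cpred_ge0 andbT.
apply: ge_ereal_sup => _ [b _ <-].
rewrite {1}/pen big_set0 sub0r max_r ?expr0n ?mul0e //.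
by rewrite oppr_le0 mulr_ge0 ?invr_ge0 ?pen_ge0.
Qed.

(** Clears the denominator of the ratio. If it is 0, a finite supremum forces the numerator to be 0,
    because a positive number over 0 is [+oo]. *)
Lemma Cpred_EFin xi S r b : Cpred U lam xi S = r%:E ->
  (Num.max (pen U lam S b - xi^-1 * pen U lam (~: S) b) 0 ^+ 2 <=
   r * (\sum_(i in S) lam i ^+ 2) * norm2n (fit U b) ^+ 2)%R.
Proof.
move=> CE; set a := Num.max _ _; rewrite -mulrA.
set c := (_ * norm2n _ ^+ 2)%R.
have : (a ^+ 2)%:E / c%:E <= r%:E.
  by rewrite -CE; apply: ereal_sup_ubound; exists b.
have c_ge0 : (0 <= c)%R.
  by rewrite mulr_ge0 ?sqr_ge0 //; apply: sumr_ge0 => i _; rewrite sqr_ge0.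
rewrite inver; have [c0|c0] := eqVneq c 0%R.
  have [->|a0] := eqVneq (a ^+ 2)%R 0%R; first by rewrite c0 mulr0.
  rewrite gt0_muley ?leye_eq //.
  by rewrite lte_fin lt_neqAle eq_sym a0 sqr_ge0.
by rewrite -EFinM lee_fin ler_pdivrMr // lt_neqAle eq_sym c0.
Qed.

(** * Oracle bounds through the prediction factor *)

Section Bounds.
Variables (A0 : R) (y fstar : 'cV[R]_n) (bh b : forall i, 'cV[R]_(d i)).
Hypotheses (A0_gt1 : (1 < A0)%R) (bh_min : is_gl_estimator U lam A0 y bh).
Hypothesis ctrl : noise_controlled U lam y fstar.
Let xi : R := ((A0 + 1) / (A0 - 1))%R.
Let D2 := (norm2n (fit U bh - fit U b) ^+ 2)%R.
Let E2 := (norm2n (fit U bh - fstar) ^+ 2)%R.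

Lemma sum_lam_gt0 S : S != finset.set0 -> (0 < \sum_(i in S) lam i ^+ 2)%R.
Proof.
case/set0Pn => i iS; rewrite (bigD1 i) //= ltr_pwDl ?exprn_gt0 //.
by apply: sumr_ge0 => j _; rewrite sqr_ge0.
Qed.

Let A0D1_gt0 : (0 < A0 + 1)%R.
Proof. by rewrite addr_gt0 // (lt_trans ltr01). Qed.

Let xi_ge0 : (0 <= xi)%R.
Proof. by rewrite divr_ge0 //; move: A0_gt1; lra. Qed.

Lemma bound_B_infty S : Cpred U lam xi S = +oo -> bound_B U lam A0 xi S = +oo.
Proof.
move=> CE; have [S0|S0] := eqVneq S finset.set0.
  by move: CE; rewrite S0 Cpred_set0 // xi_ge0.
rewrite /bound_B CE gt0_muley ?gt0_mulye //.
  by rewrite lte_fin sum_lam_gt0.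
by rewrite lte_fin exprn_gt0.
Qed.

(** With [m] equal to [A0 + 1] times the positive part, the basic inequality reads
    [D2 + E2 <= Delta + 2 m] and the prediction factor gives [m ^ 2 <= B D2]. The first bound uses
    [2 m <= B + D2], the second [2 m <= 2 B + D2 / 2], doubled at the end. *)
Lemma oracle_EFin S r : Cpred U lam xi S = r%:E ->
  let B := ((A0 + 1) ^+ 2 * r * \sum_(i in S) lam i ^+ 2)%R in
  (E2 <= B + bound_Delta U lam A0 fstar S b)%R /\
  (D2 + E2 <= 4 * B + 2 * bound_Delta U lam A0 fstar S b)%R.
Proof.
move=> CE B; have := gl_basic_inequality b S A0_gt1 bh_min ctrl.
rewrite -/D2 -/E2 -/xi; set x := (pen _ _ _ _ - _)%R => basic.
have := Cpred_EFin (fun i => bh i - b i)%R CE; rewrite fitB -/D2 -/x.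
set m := Num.max x 0%R => m_le.
have x_le : (x <= m)%R by rewrite le_max lexx.
have m_ge0 : (0 <= m)%R by rewrite le_max lexx orbT.
have {}basic : (D2 + E2 <= bound_Delta U lam A0 fstar S b + 2 * ((A0 + 1) * m))%R.
  have h : ((A0 + 1) * x <= (A0 + 1) * m)%R by rewrite ler_pM2l.
  by apply: (le_trans basic); rewrite -mulrA lerD2l ler_pM2l.
have {}m_le : (((A0 + 1) * m) ^+ 2 <= B * D2)%R.
  rewrite exprMn.
  have -> : (B * D2 = (A0 + 1) ^+ 2 * (r * (\sum_(i in S) lam i ^+ 2) * D2))%R.
    by rewrite /B !mulrA.
  by rewrite ler_wpM2l ?sqr_ge0.
have {x_le} : (0 <= (A0 + 1) * m)%R by rewrite mulr_ge0 // ltW.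
move: {x m m_ge0} ((A0 + 1) * m)%R m_le basic => m m_le basic m_ge0.
have D_ge0 : (0 <= D2)%R by rewrite sqr_ge0.
have r_ge0 : (0 <= r)%R by rewrite -lee_fin -CE Cpred_ge0.
have B_ge0 : (0 <= B)%R.
  apply: mulr_ge0; first by rewrite mulr_ge0 ?sqr_ge0.
  by apply: sumr_ge0 => i _; rewrite sqr_ge0.
have amgm (p q : R) : (0 <= p -> 0 <= q -> m ^+ 2 <= p * q -> 2 * m <= p + q)%R.
  move=> p0 q0 h; rewrite -(@ler_pXn2r _ 2) ?nnegrE ?addr_ge0 ?mulr_ge0 //.
  by have := sqr_ge0 (p - q)%R; rewrite exprMn; lra.
have h1 := amgm B D2 B_ge0 D_ge0 m_le.
have h2 : (2 * m <= 2 * B + D2 / 2)%R.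
  apply: amgm => //; [by rewrite mulr_ge0|by rewrite divr_ge0|].
  by rewrite (_ : 2 * B * (D2 / 2) = B * D2)%R //; field.
have E_ge0 : (0 <= E2)%R by rewrite sqr_ge0.
by split; lra.
Qed.

Lemma oracle S :
  E2%:E <= bound_B U lam A0 xi S + (bound_Delta U lam A0 fstar S b)%:E /\
  (D2 + E2)%:E <=
    4%:E * bound_B U lam A0 xi S + (2 * bound_Delta U lam A0 fstar S b)%:E.
Proof.
have := Cpred_ge0 xi S; case CE: (Cpred U lam xi S) => [r| |] // _.
  by rewrite /bound_B CE -!EFinM -!EFinD !lee_fin; exact: oracle_EFin.
by rewrite bound_B_infty // gt0_muley ?lte_fin // !addye // !leey.
Qed.

(** On [S] the minimum is [lam i ^+ 2], which pairs with [bound_B]. Off [S] the norm is below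
    [A0 * lam i], so the penalty is at most [A0] times the minimum, and [8 A0 pen] becomes
    [8 A0 ^ 2] times the sum of minima. *)
Lemma oracle_thresholded S :
  S = [set i | (A0 * lam i <= norm2n (U i *m b i))%R]%SET ->
  (D2 + E2)%:E <= (2 * norm2n (fit U b - fstar) ^+ 2)%:E +
    Cpred_star U lam A0 xi S *
    (\sum_i Num.min (lam i ^+ 2) (lam i * norm2n (U i *m b i)))%:E.
Proof.
move=> SE; set m := (fun i => Num.min (lam i ^+ 2) (lam i * norm2n (U i *m b i)))%R.
have m_ge0 i : (0 <= m i)%R.
  by rewrite le_min sqr_ge0 mulr_ge0 ?norm2n_ge0 ?ltW.
have mS i : i \in S -> m i = (lam i ^+ 2)%R.
  rewrite SE inE => h; apply/min_idPl; rewrite expr2 ler_pM2l //.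
  by rewrite (le_trans _ h) // ler_peMl ?ltW.
have mSc : (pen U lam (~: S) b <= A0 * \sum_(i in ~: S) m i)%R.
  rewrite /pen mulr_sumr ler_sum // => i; rewrite SE !inE -ltNge => h.
  rewrite /m; have [_|_] := lerP (lam i ^+ 2) _.
    by rewrite expr2 [leRHS]mulrCA ler_pM2l // ltW.
  by rewrite ler_peMl ?(ltW A0_gt1) // mulr_ge0 ?norm2n_ge0 ?ltW.
have sumE : (\sum_i m i = \sum_(i in S) lam i ^+ 2 + \sum_(i in ~: S) m i)%R.
  rewrite (bigID (mem S)) /=; congr (_ + _)%R; first exact: eq_bigr.
  by apply: eq_bigl => i; rewrite inE.
have Sc_ge0 : (0 <= \sum_(i in ~: S) m i)%R by exact: sumr_ge0.
rewrite -/(\sum_i m i)%R sumE.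
have := Cpred_ge0 xi S; case CE: (Cpred U lam xi S) => [r| |] // _.
  have [_] := oracle_EFin CE; set L := (\sum_(i in S) _)%R; rewrite /bound_Delta.
  have L_ge0 : (0 <= L)%R by apply: sumr_ge0 => i _; rewrite sqr_ge0.
  rewrite /Cpred_star CE -EFinM -EFin_max -EFinM -EFinD lee_fin.
  set q := Num.max _ _ => h; apply: (le_trans h).
  have q1 : (8 * A0 ^+ 2 <= q)%R by rewrite le_max lexx.
  have q2 : (4 * (A0 + 1) ^+ 2 * r <= q)%R by rewrite le_max lexx orbT.
  have h1 : (4 * (A0 + 1) ^+ 2 * r * L <= q * L)%R by rewrite ler_wpM2r.
  have h2 : (8 * A0 ^+ 2 * \sum_(i in ~: S) m i <= q * \sum_(i in ~: S) m i)%R.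
    by rewrite ler_wpM2r.
  have h3 : (8 * A0 * pen U lam (~: S) b <=
             8 * A0 * (A0 * \sum_(i in ~: S) m i))%R.
    by rewrite ler_wpM2l // !mulr_ge0 // (le_trans ler01) // ltW.
  by rewrite mulrDr; lra.
(* The factor is infinite, so [S] is nonempty, the sum of minima is positive and the right side is
   [+oo]. *)
have [S0|S0] := eqVneq S finset.set0.
  by move: CE; rewrite S0 Cpred_set0 // xi_ge0.
rewrite /Cpred_star CE gt0_muley ?lte_fin ?mulr_gt0 ?exprn_gt0 //.
rewrite maxey gt0_mulye ?lte_fin ?ltr_pwDl ?sum_lam_gt0 // addey ?leey //.
Qed.

End Bounds.
End GroupLassoOracle.

(** * Numerical bounds *)

Section ExpBounds.
Context {R : realType}.
Implicit Types (t u x : R).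

(* The Pade approximant of order [2/1] of [ln (1 + u)] at 0. *)
Lemma ln1D_le u : 0 <= u -> ln (1 + u) <= u * (6 + u) / (6 + 4 * u).
Proof.
rewrite le_eqVlt => /predU1P[<-|u0]; first by rewrite addr0 ln1 mul0r mul0r.
pose f x : R := x * (6 + x) / (6 + 4 * x) - ln (1 + x).
pose f' x : R := (6 + 2 * x) / (6 + 4 * x) - 4 * (x * (6 + x)) / (6 + 4 * x) ^+ 2 - (1 + x)^-1.
have der x : 0 <= x -> is_derive x (1 : R) f (f' x).
  move=> x0; have d0 : 6 + 4 * x != 0 by rewrite gt_eqF // ltr_pwDl // mulr_ge0.
  have l0 : 0 < 1 + x by rewrite ltr_pwDl.
  have dd : is_derive x (1 : R) (fun y => 6 + 4 * y) 4.
    by apply: is_derive_eq; rewrite add0r mul1r scaler1.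
  have dV : is_derive x (1 : R) (fun y => (6 + 4 * y)^-1) (- 4 / (6 + 4 * x) ^+ 2).
    apply: DeriveDef; first by apply: derivableV.
    by rewrite deriveV // derive_val /GRing.scale /= mulrC mulrN mulNr.
  have dn : is_derive x (1 : R) (fun y => y * (6 + y)) (6 + 2 * x).
    by apply: is_derive_eq; rewrite /= add0r !scaler1; ring.
  have dl : is_derive x (1 : R) (fun y => ln (1 + y)) (1 + x)^-1.
    have d1 : is_derive x (1 : R) (fun y => 1 + y) 1.
      have -> : (fun y : R => 1 + y) = cst 1 + id by [].
      by apply: is_derive_eq; rewrite add0r.
    by have := is_derive1_comp (is_derive1_ln l0) d1; rewrite mulr1.
  apply: (is_derive_eq (is_deriveB (is_deriveM dn dV) dl)).
  by rewrite /f' /GRing.scale /=; field; rewrite d0 gt_eqF.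
have [x||c /[!in_itv] /andP[c0 cu] fE] := @MVT R f f' 0 u u0.
- by rewrite in_itv => /andP[x0 _]; exact/der/ltW.
- apply: derivable_within_continuous => x; rewrite in_itv => /andP[x0 _].
  by have [] := der x x0.
have f0 : f 0 = 0 by rewrite /f mul0r mul0r addr0 ln1 subrr.
move: fE; rewrite f0 !subr0 => fE.
rewrite -subr_ge0 -/(f u) fE mulr_ge0 ?(ltW u0) //.
(* The derivative of the gap is a cubic monomial over a positive denominator, so the gap grows from
   its value 0 at 0. *)
have -> : f' c = 4 * c ^+ 3 / ((6 + 4 * c) ^+ 2 * (1 + c)).
  have {}c0 : 0 < c := c0.
  by rewrite /f'; field; rewrite !gt_eqF //; lra.
by rewrite divr_ge0 // ?mulr_ge0 ?exprn_ge0 ?addr_ge0 ?mulr_ge0 // ltW.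
Qed.

Lemma expR_ge_pade u : 0 <= u -> 1 + u <= expR (u * (6 + u) / (6 + 4 * u)).
Proof.
move=> u0; rewrite -[leLHS]lnK ?posrE ?ltr_pwDl // ler_expR; exact: ln1D_le.
Qed.

(** A certificate for numerical lower bounds on [expR x]: once a rational [u] is chosen, only a
    condition linear in [x] remains. *)
Lemma expR_ge n u x : 0 <= u -> n%:R * (u * (6 + u)) <= x * (6 + 4 * u) ->
  (1 + u) ^+ n <= expR x.
Proof.
move=> u0 ux.
have {}ux : n%:R * (u * (6 + u) / (6 + 4 * u)) <= x.
  by rewrite mulrA ler_pdivrMr // ltr_pwDl // mulr_ge0.
apply: le_trans (_ : expR (n%:R * (u * (6 + u) / (6 + 4 * u))) <= _).
  by rewrite expRM_natl lerXn2r ?nnegrE ?addr_ge0 ?expR_ge0 // expR_ge_pade.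
by rewrite ler_expR.
Qed.

(** The square of [1 + v <= expR v] at [v = - x / 2]; the base is nonnegative since [x <= 2]. It
    serves as an upper bound on [expR x]. *)
Lemma expRN_ge x : x <= 2 -> (1 - x / 2) ^+ 2 <= expR (- x).
Proof.
move=> x2; have -> : expR (- x) = expR (- (x / 2)) ^+ 2.
  by rewrite -expRM_natl; congr expR; field.
by rewrite lerXn2r ?nnegrE ?expR_ge0 ?expR_ge1Dx //; lra.
Qed.

End ExpBounds.

(** * Bounds on the chi-square tail uniform in [t] *)

Section ChiTail.
Context {R : realType}.
Implicit Types (t x : R) (m : nat).

(* The bound of [tail_sqnorm_on] below with the best [q], namely [x / sqrt (m + 2)]. *)
Definition chi_tail m x : R := m%:R / x ^+ 2 * (x / Num.sqrt m.+2%:R) ^+ m.+2 *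
  expR (- ((1 - (x / Num.sqrt m.+2%:R) ^- 2) * x ^+ 2 / 2)).

Definition kappa m : R := (Num.sqrt m%:R / Num.sqrt m.+2%:R) ^+ m.+2 * expR 1.

Lemma sqrt_nat_gt0 m : (0 < m)%N -> 0 < Num.sqrt m%:R :> R.
Proof. by move=> m0; rewrite sqrtr_gt0 ltr0n. Qed.

(** Since [q ^ 2 = x ^ 2 / (m + 2)], the exponent is [1 + (m - x ^ 2) / 2]; the remaining powers of
    [sqrt m] and [sqrt (m + 2)] make up [kappa m]. *)
Lemma chi_tailE m x : (0 < m)%N -> 0 < x ->
  chi_tail m x = kappa m * (x / Num.sqrt m%:R) ^+ m * expR ((m%:R - x ^+ 2) / 2).
Proof.
move=> m0 x0; rewrite /chi_tail /kappa.
have a0 := sqrt_nat_gt0 m0; have b0 : 0 < Num.sqrt m.+2%:R :> R by exact: sqrt_nat_gt0.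
have a2 : Num.sqrt m%:R ^+ 2 = m%:R :> R by rewrite sqr_sqrtr.
have b2 : Num.sqrt m.+2%:R ^+ 2 = m%:R + 2 :> R by rewrite sqr_sqrtr // -addn2 natrD.
move: (Num.sqrt m%:R) (Num.sqrt m.+2%:R) a0 b0 a2 b2 => a b a0 b0 a2 b2.
have -> : expR (- ((1 - (x / b) ^- 2) * x ^+ 2 / 2)) =
    expR 1 * expR ((m%:R - x ^+ 2) / 2).
  rewrite -expRD; congr expR; rewrite exprMn exprVn b2; field.
  by rewrite -b2 !gt_eqF // exprn_gt0.
have XD (y : R) : y ^+ m.+2 = y ^+ m * y ^+ 2 by rewrite -exprD addn2.
rewrite !exprMn !exprVn !XD -a2.
have am0 : a ^+ m != 0 by rewrite expf_neq0 ?gt_eqF.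
have bm0 : b ^+ m != 0 by rewrite expf_neq0 ?gt_eqF.
move: (a ^+ m) (b ^+ m) (x ^+ m) (expR _) (expR _) am0 bm0 => am bm xm e1 e2 am0 bm0.
by field; rewrite am0 bm0 !gt_eqF.
Qed.

Lemma kappa_ge0 m : 0 <= kappa m.
Proof. by rewrite mulr_ge0 ?expR_ge0 // exprn_ge0 // divr_ge0 ?sqrtr_ge0. Qed.

(** [m / (m + 2) = 1 - 2 / (m + 2)] is at most [expR (- 2 / (m + 2))]; the square root, raised to
    the power [m + 2], cancels the factor [expR 1]. *)
Lemma kappa_le1 m : kappa m <= 1.
Proof.
have m2 : 0 < m.+2%:R :> R by rewrite ltr0n.
have r_ge0 : 0 <= Num.sqrt m%:R / Num.sqrt m.+2%:R :> R by rewrite divr_ge0 ?sqrtr_ge0.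
have : Num.sqrt m%:R / Num.sqrt m.+2%:R <= expR (- m.+2%:R^-1) :> R.
  rewrite -(@ler_pXn2r _ 2) ?nnegrE ?expR_ge0 // exprMn exprVn !sqr_sqrtr ?ler0n //.
  rewrite -expRM_natl; apply: le_trans (expR_ge1Dx _).
  have -> : m%:R = m.+2%:R - 2 :> R by rewrite -addn2 natrD addrK.
  by rewrite mulrBl divff ?gt_eqF // mulrN.
move=> le_expR; rewrite /kappa -ler_pdivlMr ?expR_gt0 // mul1r -expRN.
apply: le_trans (_ : expR (- m.+2%:R^-1) ^+ m.+2 <= _).
  by rewrite lerXn2r ?nnegrE ?expR_ge0.
by rewrite -expRM_natl mulrN divff // gt_eqF.
Qed.

(** Reduces the bound for all [t] to one quadratic inequality. Here [a0] is a lower bound of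
    [sqrt m], and [t0] is the point where [t <= t0 * expR (t / t0 - 1)] is tight. With
    [u = t / sqrt m], the Pade bound on [(1 + u) ^+ m] leaves the exponent [- 3 t ^ 2 / (6 + 4 u)],
    and [eta] is the decay guaranteed after adding [t / t0 - 1]. *)
Lemma chi_tail_near m t a0 t0 eta : (0 < m)%N -> 0 < t -> 0 < a0 -> a0 ^+ 2 <= m%:R ->
  0 < t0 -> (t / t0 - 1 + eta) * (6 + 4 * t / a0) <= 3 * t ^+ 2 ->
  t * expR (t ^+ 2 / 2) * chi_tail m (Num.sqrt m%:R + t) <=
  kappa m * (t0 * expR (- eta)).
Proof.
move=> m0 t_gt0 a0_gt0 a0m t0_gt0 quad.
have a_gt0 : 0 < Num.sqrt m%:R :> R := sqrt_nat_gt0 m0.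
rewrite chi_tailE ?addr_gt0 //.
have a2 : Num.sqrt m%:R ^+ 2 = m%:R :> R by rewrite sqr_sqrtr.
have a0a : a0 <= Num.sqrt m%:R.
  by rewrite -(@ler_pXn2r _ 2) ?nnegrE ?a2 ?(ltW a_gt0) ?(ltW a0_gt0).
set a := Num.sqrt m%:R in a_gt0 a2 a0a *; pose u := t / a.
have u_gt0 : 0 < u by rewrite divr_gt0.
have -> : (a + t) / a = 1 + u by rewrite mulrDl divff // gt_eqF.
set E := m%:R * (u * (6 + u) / (6 + 4 * u)).
have pow_le : (1 + u) ^+ m <= expR E.
  rewrite /E expRM_natl lerXn2r ?nnegrE ?expR_ge0 ?addr_ge0 ?(ltW u_gt0) //.
  exact/expR_ge_pade/ltW.
have t_le : t <= t0 * expR (t / t0 - 1).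
  have := expR_ge1Dx (t / t0 - 1); rewrite addrC subrK -(ler_pM2l t0_gt0).
  by rewrite mulrCA divff ?mulr1 // gt_eqF.
have -> : t * expR (t ^+ 2 / 2) * (kappa m * (1 + u) ^+ m * expR ((m%:R - (a + t) ^+ 2) / 2))
    = kappa m * (t * (1 + u) ^+ m * expR (- (a * t))).
  have -> : expR (- (a * t)) = expR (t ^+ 2 / 2) * expR ((m%:R - (a + t) ^+ 2) / 2).
    by rewrite -expRD -a2; congr expR; field.
  by ring.
rewrite ler_wpM2l ?kappa_ge0 //.
apply: le_trans (_ : t0 * expR (t / t0 - 1) * expR E * expR (- (a * t)) <= _).
  rewrite ler_wpM2r ?expR_ge0 //; apply: ler_pM t_le pow_le; first exact: ltW.
  by rewrite exprn_ge0 // addr_ge0 // ltW.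
rewrite -!mulrA ler_wpM2l ?(ltW t0_gt0) // -!expRD ler_expR.
have d0 : 0 < 6 + 4 * t / a0 by rewrite addr_gt0 // divr_gt0 // mulr_gt0.
have d : 0 < 6 + 4 * u by rewrite addr_gt0 // mulr_gt0.
have -> : E - a * t = - (3 * t ^+ 2 / (6 + 4 * u)).
  have tE : t = a * u by rewrite mulrCA divff ?mulr1 // gt_eqF.
  have pade v : 0 < 6 + 4 * v -> a ^+ 2 * (v * (6 + v) / (6 + 4 * v)) - a * (a * v) =
      - (3 * (a * v) ^+ 2 / (6 + 4 * v)).
    by move=> v0; field; rewrite gt_eqF.
  by have := pade u d; rewrite -tE a2.
have : 3 * t ^+ 2 / (6 + 4 * t / a0) <= 3 * t ^+ 2 / (6 + 4 * u).
  apply: ler_wpM2l; first by rewrite mulr_ge0 ?sqr_ge0.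
  rewrite lef_pV2 ?posrE // lerD2l -mulrA ler_wpM2l //.
  by rewrite ler_wpM2l ?(ltW t_gt0) // lef_pV2.
rewrite -ler_pdivlMr // in quad; lra.
Qed.

(** The right side is the value of the left side at [t = 1]. Writing [t = 1 + tau], the bounds
    [t <= expR tau] and [(1 + tau / b) ^+ m <= expR (m * tau / b)] leave an excess exponent equal to
    [- (tau / b) * (m - 1)], which is nonpositive. *)
Lemma chi_tail_far m t : (0 < m)%N -> 1 <= t ->
  t * expR (t ^+ 2 / 2) * chi_tail m (Num.sqrt (2 * m%:R) + t) <=
  kappa m * ((Num.sqrt 2 + (Num.sqrt m%:R)^-1) ^+ m *
    expR (- (m%:R / 2 + Num.sqrt 2 * Num.sqrt m%:R))).
Proof.
move=> m0 t1; have t_gt0 : 0 < t by exact: lt_le_trans t1.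
have a_gt0 : 0 < Num.sqrt m%:R :> R := sqrt_nat_gt0 m0.
have s_gt0 : 0 < Num.sqrt 2 :> R by rewrite sqrtr_gt0.
rewrite sqrtrM //.
rewrite chi_tailE ?addr_gt0 ?mulr_gt0 //.
have a2 : Num.sqrt m%:R ^+ 2 = m%:R :> R by rewrite sqr_sqrtr.
have s2 : Num.sqrt 2 ^+ 2 = 2 :> R by rewrite sqr_sqrtr.
have a_ge1 : 1 <= Num.sqrt m%:R :> R.
  by rewrite -(@ler_pXn2r _ 2) ?nnegrE ?a2 ?expr1n ?ler1n // ltW.
set a := Num.sqrt m%:R in a_gt0 a2 a_ge1 *; set s := Num.sqrt 2 in s_gt0 s2 *.
pose c := s + a^-1; pose b := s * a + 1; pose tau := t - 1.
have b_gt0 : 0 < b by rewrite addr_gt0 // mulr_gt0.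
have c_gt0 : 0 < c by rewrite addr_gt0 // invr_gt0.
have tau_ge0 : 0 <= tau by rewrite subr_ge0.
have -> : (s * a + t) / a = c * (1 + tau / b).
  have bN0 : s * a + 1 != 0 by rewrite gt_eqF.
  by rewrite /c /b /tau; field; rewrite bN0 gt_eqF.
have -> : t * expR (t ^+ 2 / 2) * (kappa m * (c * (1 + tau / b)) ^+ m *
      expR ((m%:R - (s * a + t) ^+ 2) / 2))
    = kappa m * (c ^+ m * (t * (1 + tau / b) ^+ m * expR (- (m%:R / 2 + s * a * t)))).
  have -> : expR (- (m%:R / 2 + s * a * t)) =
      expR (t ^+ 2 / 2) * expR ((m%:R - (s * a + t) ^+ 2) / 2).
    rewrite -expRD -a2; congr expR.
    have -> : (s * a + t) ^+ 2 = 2 * a ^+ 2 + 2 * (s * a * t) + t ^+ 2.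
      by rewrite sqrrD exprMn s2 -mulr_natl; ring.
    by field.
  by rewrite exprMn; ring.
rewrite ler_wpM2l ?kappa_ge0 // ler_wpM2l ?exprn_ge0 ?(ltW c_gt0) //.
have t_le : t <= expR tau by have := expR_ge1Dx tau; rewrite /tau addrC subrK.
have pow_le : (1 + tau / b) ^+ m <= expR (m%:R * (tau / b)).
  rewrite expRM_natl lerXn2r ?nnegrE ?expR_ge0 ?expR_ge1Dx //.
  by rewrite addr_ge0 // divr_ge0 // ltW.
apply: le_trans (_ : expR tau * expR (m%:R * (tau / b)) * expR (- (m%:R / 2 + s * a * t)) <= _).
  rewrite ler_wpM2r ?expR_ge0 //; apply: ler_pM t_le pow_le; first exact: ltW.
  by rewrite exprn_ge0 // addr_ge0 // divr_ge0 // ltW.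
rewrite -!expRD ler_expR -subr_ge0.
have -> : - (m%:R / 2 + s * a) - (tau + m%:R * (tau / b) + - (m%:R / 2 + s * a * t)) =
    tau / b * (m%:R - 1).
  have -> : m%:R - 1 = (s * a - 1) * b - m%:R.
    by rewrite /b -subr_sqr_1 exprMn s2 a2; ring.
  by rewrite /tau; field; rewrite gt_eqF.
by rewrite mulr_ge0 ?divr_ge0 ?(ltW b_gt0) // subr_ge0 ler1n.
Qed.

End ChiTail.

(** * Numerical values at dyadic group sizes *)

Section Constants.
Context {R : realType}.
Implicit Types (t : R) (m k j : nat).

Definition near_bound j : R :=
  match j with 0 => 47 / 100 | 1 => 56 / 100 | _ => 8 / 10 end.

Definition far_bound j : R :=
  match j with
  | 0 => 19 / 100 | 1 => 16 / 100 | 2 => 1 / 10 | k.+3 => 3 / 64 * 3^-1 ^+ k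
  end.

(* A potential dominating the sum of [far_bound] from [j] on. *)
Definition far_tail j : R :=
  match j with
  | 0 => 53 / 100 | 1 => 34 / 100 | 2 => 18 / 100 | k.+3 => 9 / 128 * 3^-1 ^+ k
  end.

Lemma far_tail_ge0 j : 0 <= far_tail j.
Proof. by case: j => [|[|[|k]]] /=; rewrite ?mulr_ge0 ?exprn_ge0 //; lra. Qed.

(** From index 3 on, [far_bound] is geometric of ratio 1/3 and sums to [3/64 * 3/2 = 9/128]; the
    first three values of [far_tail] are partial sums, rounded up. *)
Lemma far_tailS j : far_bound j + far_tail j.+1 <= far_tail j.
Proof.
case: j => [|[|[|k]]] /=; [lra|lra|rewrite expr0; lra|rewrite exprS; lra].
Qed.

(** There is no slack at [j = 0], where [47/100 + 53/100 = 1]. *)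
Lemma near_far_le1 j : near_bound j + far_tail j <= 1.
Proof.
case: j => [|[|[|k]]] /=; [lra|lra|lra|].
have : (3^-1 : R) ^+ k <= 1 by apply: exprn_ile1; lra.
lra.
Qed.

Lemma sqrt2_bounds : 41 / 29 <= Num.sqrt (2 : R) <= 17 / 12.
Proof.
have s2 : Num.sqrt 2 ^+ 2 = 2 :> R by rewrite sqr_sqrtr.
have s0 : 0 <= Num.sqrt 2 :> R by exact: sqrtr_ge0.
by apply/andP; split; nra.
Qed.

Lemma sqrt3_ge : 45 / 26 <= Num.sqrt 3 :> R.
Proof.
have s2 : Num.sqrt 3 ^+ 2 = 3 :> R by rewrite sqr_sqrtr.
have s0 : 0 <= Num.sqrt 3 :> R by exact: sqrtr_ge0.
nra.
Qed.

Lemma sqrt4 : Num.sqrt 4 = 2 :> R.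
Proof. by rewrite (_ : 4 = 2 ^+ 2) ?sqrtr_sqr ?ger0_norm // expr2; lra. Qed.

Lemma kappa1 : kappa 1 = expR 1 / (3 * Num.sqrt 3) :> R.
Proof.
have s2 : Num.sqrt 3 ^+ 2 = 3 :> R by rewrite sqr_sqrtr.
have s0 : Num.sqrt 3 != 0 :> R by rewrite gt_eqF // sqrtr_gt0.
rewrite /kappa sqrtr1; move: (Num.sqrt 3) s2 s0 => s s2 s0.
by rewrite -s2; field.
Qed.

Lemma kappa2 : kappa 2 = expR 1 / 4 :> R.
Proof.
have s2 : Num.sqrt 2 ^+ 2 = 2 :> R by rewrite sqr_sqrtr.
rewrite /kappa sqrt4 exprMn (exprM _ 2 2) s2; by field.
Qed.

Lemma kappa4 : kappa 4 = 8 / 27 * expR 1 :> R.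
Proof.
have s2 : Num.sqrt 6 ^+ 2 = 6 :> R by rewrite sqr_sqrtr.
rewrite /kappa sqrt4 exprMn exprVn (exprM (Num.sqrt 6) 2 3) s2; by field.
Qed.

Lemma near_param m t : (0 < m)%N -> 1 <= t ->
  t * expR (t ^+ 2 / 2) * chi_tail m (Num.sqrt m%:R + t) <=
  kappa m * (17 / 10 * expR (- (67 / 100))).
Proof.
move=> m0 t1; apply: (@chi_tail_near _ m t 1) => //; try lra.
- by rewrite expr1n ler1n.
(* The two sides differ by a quadratic in [t] with vertex 939/550; the square completes it. The
   analogous squares below arise in the same way. *)
- by rewrite divr1; have := sqr_ge0 (t - 939 / 550); lra.
Qed.

(** For a parametric component, whose single group has arbitrary size and may use the whole budget
    1. *)
Lemma chi_tail_near1 m t : (0 < m)%N -> 1 <= t ->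
  t * expR (t ^+ 2 / 2) * chi_tail m (Num.sqrt m%:R + t) <= 1.
Proof.
move=> m0 t1; apply: le_trans (near_param m0 t1) _.
have : 17 / 10 <= expR (67 / 100) :> R.
  have : (1 + 7 / 10) ^+ 1 <= expR (67 / 100) :> R by apply: expR_ge; lra.
  rewrite expr1; lra.
have e0 : 0 < expR (67 / 100) :> R by exact: expR_gt0.
move=> le_e; apply: mulr_ile1; rewrite ?kappa_ge0 ?kappa_le1 ?mulr_ge0 ?expR_ge0 //.
by rewrite expRN ler_pdivrMr // mul1r.
Qed.

(** The lower bounds 1, 14/10 and 2 of [sqrt m] serve for [m = 1], [m = 2] and [m >= 4]. The exact
    [kappa] is used in the first two cases, [kappa <= 1] in the last. *)
Lemma chi_tail_near_pow j t : 1 <= t ->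
  t * expR (t ^+ 2 / 2) * chi_tail (2 ^ j) (Num.sqrt (2 ^ j)%:R + t) <= near_bound j.
Proof.
move=> t1; case: j => [|[|j]] /=.
- apply: le_trans (near_param _ t1) _ => //; rewrite expn0 kappa1.
  have e : expR (33 / 100) * (1 - 33 / 100 / 2) ^+ 2 <= 1 :> R.
    rewrite mulrC -ler_pdivlMr ?expR_gt0 // mul1r -expRN.
    by apply: expRN_ge; lra.
  have s0 : 0 < Num.sqrt 3 :> R by rewrite sqrtr_gt0.
  have -> : expR 1 / (3 * Num.sqrt 3) * (17 / 10 * expR (- (67 / 100))) =
      17 / 10 * expR (33 / 100) / (3 * Num.sqrt 3) :> R.
    rewrite (_ : expR (33 / 100) = expR 1 * expR (- (67 / 100))); last first.
      by rewrite -expRD; congr expR; lra.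
    by field; rewrite gt_eqF.
  rewrite ler_pdivrMr ?mulr_gt0 //; have := sqrt3_ge; lra.
- apply: le_trans (_ : kappa 2 * (15 / 10 * expR (- (65 / 100))) <= _).
    apply: (@chi_tail_near _ 2 t (14 / 10)) => //; try lra.
    by have := sqr_ge0 (t - 63 / 46); lra.
  have e : expR (35 / 100) * (1 - 35 / 100 / 2) ^+ 2 <= 1 :> R.
    rewrite mulrC -ler_pdivlMr ?expR_gt0 // mul1r -expRN.
    by apply: expRN_ge; lra.
  rewrite kappa2.
  have -> : expR 1 / 4 * (15 / 10 * expR (- (65 / 100))) =
      15 / 40 * expR (35 / 100) :> R.
    rewrite (_ : expR (35 / 100) = expR 1 * expR (- (65 / 100))); last first.
      by rewrite -expRD; congr expR; lra.
    by field.
  lra.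
- have m0 : (0 < 2 ^ j.+2)%N by rewrite expn_gt0.
  apply: le_trans (_ : kappa (2 ^ j.+2) * (13 / 10 * expR (- (58 / 100))) <= _).
    apply: (@chi_tail_near _ _ t 2) => //; try lra.
    + by rewrite -natrX ler_nat leq_exp2l.
    + by have := sqr_ge0 (t - 1227 / 950); lra.
  have : 163 / 100 <= expR (58 / 100) :> R.
    have : (1 + 63 / 100) ^+ 1 <= expR (58 / 100) :> R by apply: expR_ge; lra.
    rewrite expr1; lra.
  have e0 : 0 < expR (58 / 100) :> R by exact: expR_gt0.
  move=> le_e; apply: le_trans (_ : 1 * (13 / 10 * expR (- (58 / 100))) <= _).
    by rewrite ler_wpM2r ?kappa_le1 // mulr_ge0 ?expR_ge0 //; lra.
  rewrite mul1r expRN ler_pdivrMr //; lra.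
Qed.

(** In this and the next two values, the factor [expR 1] of [kappa] cancels against the exponential,
    so that one numerical lower bound on an exponential suffices. *)
Lemma far_value1 (s := Num.sqrt 2 : R) :
  kappa 1 * ((s + 1) * expR (- (1 / 2 + s))) <= 19 / 100.
Proof.
have /andP[] := sqrt2_bounds; rewrite -/s; move: (s) => {}s s_lb s_ub.
rewrite kappa1; have r0 : 0 < Num.sqrt 3 :> R by rewrite sqrtr_gt0.
have -> : expR (- (1 / 2 + s)) = (expR 1 * expR (s - 1 / 2))^-1.
  by rewrite -expRD -expRN; congr expR; field.
have : (1 + 23 / 40) ^+ 2 <= expR (s - 1 / 2) :> R by apply: expR_ge; lra.
move: (expR (s - _)) (expR_gt0 (s - 1 / 2)) (expR 1) (expR_gt0 (1 : R)) => y y0 e e0 y_ge.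
move: (Num.sqrt 3) r0 (@sqrt3_ge) => r r0 r_ge.
have -> : e / (3 * r) * ((s + 1) * (e * y)^-1) = (s + 1) / (3 * (r * y)).
  by field; rewrite !gt_eqF.
rewrite ler_pdivrMr ?mulr_gt0 //.
have : 45 / 26 * (1 + 23 / 40) ^+ 2 <= r * y by apply: ler_pM => //; lra.
lra.
Qed.

Lemma far_value2 (s := Num.sqrt 2 : R) :
  kappa 2 * ((s + s^-1) ^+ 2 * expR (- (2 / 2 + s * s))) <= 16 / 100.
Proof.
have s0 : s != 0 by rewrite gt_eqF // sqrtr_gt0.
have s2 : s ^+ 2 = 2 by rewrite sqr_sqrtr.
have -> : (s + s^-1) ^+ 2 = 9 / 2.
  rewrite sqrrD exprVn s2 divff //; lra.
have -> : expR (- (2 / 2 + s * s)) = (expR 1 * expR 2)^-1.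
  by rewrite -expr2 s2 -expRD -expRN; congr expR; field.
have : (1 + 16 / 25) ^+ 4 <= expR 2 :> R by apply: expR_ge; lra.
rewrite kappa2; move: (expR 2) (expR_gt0 (2 : R)) (expR 1) (expR_gt0 (1 : R)) => y y0 e e0 y_ge.
have -> : e / 4 * (9 / 2 * (e * y)^-1) = 9 / 8 / y by field; rewrite !gt_eqF.
rewrite ler_pdivrMr //; lra.
Qed.

Lemma far_value4 (s := Num.sqrt 2 : R) :
  kappa 4 * ((s + 2^-1) ^+ 4 * expR (- (4 / 2 + s * 2))) <= 1 / 10.
Proof.
have /andP[] := sqrt2_bounds; rewrite -/s; move: (s) => {}s s_lb s_ub.
have -> : expR (- (4 / 2 + s * 2)) = (expR 1 * expR (1 + 2 * s))^-1.
  by rewrite -expRD -expRN; congr expR; field.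
have : (1 + 20 / 13) ^+ 4 <= expR (1 + 2 * s) :> R by apply: expR_ge; lra.
rewrite kappa4; move: (expR (1 + _)) (expR_gt0 (1 + 2 * s)) (expR 1) (expR_gt0 (1 : R)).
move=> y y0 e e0 y_ge.
have s4 : (s + 2^-1) ^+ 4 <= (23 / 12) ^+ 4 by rewrite lerXn2r ?nnegrE //; lra.
move: (_ ^+ 4) s4 => z z_le.
have -> : 8 / 27 * e * (z * (e * y)^-1) = 8 / 27 * z / y by field; rewrite !gt_eqF.
rewrite ler_pdivrMr //; lra.
Qed.

(** With [M = m / 2] and [a = sqrt m], the bound [(s + 1 / a) ^ m <= 2 ^ M * expR (s * a / 2)]
    leaves [(2 / e) ^ M * expR (- s * a / 2)]. Then [(2 / e) ^ 4 <= 1/3] and [s * a >= 4] give the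
    geometric decay. *)
Lemma far_value_pow k (s := Num.sqrt 2 : R) (m := (2 ^ k.+3)%N) :
  kappa m * ((s + (Num.sqrt m%:R)^-1) ^+ m * expR (- (m%:R / 2 + s * Num.sqrt m%:R))) <=
  3 / 64 * 3^-1 ^+ k.
Proof.
have s2 : s ^+ 2 = 2 by rewrite sqr_sqrtr.
have s_gt0 : 0 < s by rewrite sqrtr_gt0.
have m0 : (0 < m)%N by rewrite expn_gt0.
pose M := (2 ^ k.+2)%N.
have mM : m = (2 * M)%N by rewrite /m expnS.
have a_gt0 : 0 < Num.sqrt m%:R :> R by exact: sqrt_nat_gt0.
have a2 : Num.sqrt m%:R ^+ 2 = m%:R :> R by rewrite sqr_sqrtr.
move: (Num.sqrt m%:R) a_gt0 a2 => a a_gt0 a2.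
have sa : 4 <= s * a.
  rewrite -(@ler_pXn2r _ 2) ?nnegrE ?mulr_ge0 ?(ltW s_gt0) ?(ltW a_gt0) //.
  rewrite exprMn s2 a2 -natrX -natrM ler_nat -expnS /=.
  by rewrite -[(4 ^ 2)%N]/(2 ^ 4)%N leq_exp2l.
have pow_le : (s + a^-1) ^+ m <= 2 ^+ M * expR (s * a / 2).
  have -> : s + a^-1 = s * (1 + s * a / (2 * a ^+ 2)).
    rewrite mulrDr mulr1 mulrA; congr (_ + _).
    have -> : s * (s * a) = 2 * a by rewrite mulrA -expr2 s2.
    by field; rewrite gt_eqF.
  rewrite exprMn {1}mM exprM s2 ler_wpM2l ?exprn_ge0 //.
  have -> : expR (s * a / 2) = expR (s * a / (2 * a ^+ 2)) ^+ m.
    by rewrite -expRM_natl; congr expR; rewrite -a2; field; rewrite gt_eqF.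
  rewrite lerXn2r ?nnegrE ?expR_ge0 ?expR_ge1Dx // addr_ge0 // divr_ge0 //.
    by rewrite mulr_ge0 ?ltW.
  by rewrite mulr_ge0 ?exprn_ge0 ?ltW.
have eM : expR (- (m%:R / 2 + s * a)) = expR (- 1) ^+ M * expR (- (s * a)).
  rewrite -expRM_natl -expRD; congr expR; rewrite mM natrM; by field.
apply: le_trans (_ : 1 * (2 ^+ M * expR (s * a / 2) * (expR (- 1) ^+ M * expR (- (s * a)))) <= _).
  apply: ler_pM; rewrite ?kappa_ge0 ?kappa_le1 //.
    by rewrite mulr_ge0 ?expR_ge0 // exprn_ge0 // addr_ge0 ?invr_ge0 ?ltW.
  by rewrite eM ler_wpM2r // mulr_ge0 ?exprn_ge0 ?expR_ge0.
have -> : 1 * (2 ^+ M * expR (s * a / 2) * (expR (- 1) ^+ M * expR (- (s * a)))) =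
    (2 * expR (- 1)) ^+ M * expR (- (s * a / 2)).
  rewrite exprMn (_ : expR (- (s * a / 2)) = expR (s * a / 2) * expR (- (s * a))).
    by ring.
  by rewrite -expRD; congr expR; field.
have e1 : (1 + 16 / 25) ^+ 2 <= expR 1 :> R by apply: expR_ge; lra.
have e1N : expR (- 1) * (8 / 3) <= 1 :> R.
  by rewrite expRN mulrC ler_pdivrMr ?expR_gt0 // mul1r; lra.
have e1N_ge0 : 0 <= expR (- 1) :> R := expR_ge0 _.
have e2 : (2 * expR (- 1)) ^+ 4 <= 3^-1 :> R.
  apply: le_trans (_ : (2 * (3 / 8)) ^+ 4 <= _); last by lra.
  by rewrite lerXn2r ?nnegrE ?mulr_ge0 //; lra.
have e3 : expR (- (s * a / 2)) <= 9 / 64.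
  apply: le_trans (_ : expR (- 1) ^+ 2 <= _).
    by rewrite -expRM_natl ler_expR; lra.
  apply: le_trans (_ : (3 / 8) ^+ 2 <= _); last by lra.
  by rewrite lerXn2r ?nnegrE //; lra.
(* [M = 4 * 2 ^ k] is at least [4 * (k + 1)], which yields [k + 1] factors 1/3. *)
have e4 : (2 * expR (- 1)) ^+ M <= 3^-1 ^+ k.+1 :> R.
  apply: le_trans (_ : (2 * expR (- 1)) ^+ (4 * k.+1) <= _).
    apply: ler_wiXn2l; rewrite ?mulr_ge0 //; first by lra.
    by rewrite /M !expnS mulnA leq_mul2l /= ltn_expl.
  by rewrite exprM lerXn2r ?nnegrE ?exprn_ge0 ?mulr_ge0 //; lra.
apply: le_trans (_ : 3^-1 ^+ k.+1 * (9 / 64) <= _).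
  by apply: ler_pM; rewrite ?exprn_ge0 ?mulr_ge0 ?expR_ge0.
by rewrite exprS; lra.
Qed.

Lemma chi_tail_far_pow j t : 1 <= t ->
  t * expR (t ^+ 2 / 2) * chi_tail (2 ^ j) (Num.sqrt (2 ^ j.+1)%:R + t) <= far_bound j.
Proof.
move=> t1; have m0 : (0 < 2 ^ j)%N by rewrite expn_gt0.
have := chi_tail_far m0 t1; rewrite -natrM -expnS => /le_trans; apply.
case: j {m0} => [|[|[|k]]].
- by rewrite expn0 sqrtr1 invr1 expr1 mulr1; exact: far_value1.
- by rewrite expn1; exact: far_value2.
- by rewrite -[(2 ^ 2)%N]/4%N sqrt4; exact: far_value4.
- exact: far_value_pow.
Qed.

End Constants.

(** * Gaussian tails of projections *)

Section IntegralTransfer.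
Local Open Scope classical_set_scope.
Local Open Scope ereal_scope.
Import HBNNSimple.

(** Simple functions and monotone convergence. The weight [G] is later a product of independent
    factors, a normal density, or the constant 1. *)
Lemma ge0_integral_density d d' (T : measurableType d) (T' : measurableType d')
    (R : realType) (mu : {measure set T -> \bar R}) (nu : {measure set T' -> \bar R})
    (G : T -> R) (X : T -> T') (c : R) (f : T' -> R) :
  measurable_fun setT G -> (forall x, 0 <= G x)%R -> measurable_fun setT X ->
  (0 <= c)%R ->
  (forall B, measurable B ->
    \int[mu]_x (G x * \1_B (X x))%:E = c%:E * nu B) ->
  measurable_fun setT f -> (forall x, 0 <= f x)%R ->
  \int[mu]_x (G x * f (X x))%:E = c%:E * \int[nu]_y (f y)%:E.
Proof.
move=> mG G0 mX c0 GB mf f0.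
have /measurable_EFinP mfE := mf.
pose f_ := nnsfun_approx measurableT mfE.
have f_cvg y : EFin \o f_ ^~ y @ \oo --> (EFin \o f) y.
  by apply: cvg_nnsfun_approx => // ? _; rewrite lee_fin.
have mGf n : measurable_fun setT (fun x => (G x * f_ n (X x))%:E).
  apply/measurable_EFinP/measurable_funM => //.
  by apply: measurableT_comp.
transitivity (limn (fun n => \int[mu]_x (G x * f_ n (X x))%:E)).
  rewrite -monotone_convergence //.
  - apply: eq_integral => x _; apply/esym/cvg_lim => //.
    under eq_fun do rewrite EFinM.
    rewrite EFinM; apply: cvgeZl => //; exact: f_cvg.
  - by move=> n x _; rewrite lee_fin mulr_ge0.
  - move=> x _ m n mn; rewrite lee_fin ler_wpM2l //.
    exact/lefP/nd_nnsfun_approx.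
have -> : \int[nu]_y (f y)%:E = limn (fun n => \int[nu]_y (f_ n y)%:E).
  rewrite -monotone_convergence //.
  - by apply: eq_integral => x _; apply/esym/cvg_lim => //; exact: f_cvg.
  - by move=> n; exact/measurable_EFinP.
  - by move=> n x _; rewrite lee_fin.
  - by move=> x _ m n mn; rewrite lee_fin; exact/lefP/nd_nnsfun_approx.
rewrite -limeMl //; last first.
  apply: ereal_nondecreasing_is_cvgn => m n mn; apply: ge0_le_integral => //.
  - by move=> x _; rewrite lee_fin.
  - exact/measurable_EFinP.
  - exact/measurable_EFinP.
  - by move=> x _; rewrite lee_fin; exact/lefP/nd_nnsfun_approx.
congr (limn _); apply/funext => n.
transitivity (\sum_(k \in range (f_ n))
    \int[mu]_x (k%:E * (G x * \1_(f_ n @^-1` [set k]) (X x))%:E)).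
  rewrite -ge0_integral_fsum //.
  - apply: eq_integral => x _; rewrite fimfunE mulr_fsumr -fsumEFin //.
    by apply: eq_fsbigr => k _; rewrite -EFinM mulrCA.
  - move=> k; apply: measurable_funeM; apply/measurable_EFinP/measurable_funM => //.
    by apply: measurableT_comp => //; exact: measurable_indic.
  - move=> k x _; rewrite -EFinM lee_fin mulrCA mulr_ge0 //.
    exact: nnfun_muleindic_ge0.
rewrite integralT_nnsfun sintegralE ge0_mule_fsumr; last first.
  by move=> k; exact: nnsfun_mulemu_ge0.
apply: eq_fsbigr => k /[!inE] -[y _ <-].
rewrite ge0_integralZl //.
- by rewrite GB // muleCA.
- apply/measurable_EFinP/measurable_funM => //.
  by apply: measurableT_comp => //; exact: measurable_indic.
- by move=> x _; rewrite lee_fin mulr_ge0.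
- by rewrite lee_fin.
Qed.

End IntegralTransfer.

(** * Expectation of a product of independent variables *)

Section Independence.
Local Open Scope classical_set_scope.
Local Open Scope ereal_scope.
Context {d : measure_display} {T : measurableType d} {R : realType}.
Variable P : probability T R.

Lemma mutually_independent_integral n (X : 'I_n -> {RV P >-> R}) (F : 'I_n -> R -> R)
    (m : 'I_n -> R) :
  mutually_independent X ->
  (forall i, measurable_fun setT (F i)) -> (forall i x, 0 <= F i x)%R ->
  (forall i, \int[P]_w (F i (X i w))%:E = (m i)%:E) ->
  \int[P]_w (\prod_i F i (X i w))%:E = (\prod_i m i)%:E.
Proof.
move=> indep.
have mX i (B : set R) : measurable B -> measurable (X i @^-1` B).
  by move=> mB; rewrite -[_ @^-1` _]setTI; exact: measurable_funPT.
(* Induction on the number of leading factors that are arbitrary functions, the others being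
   indicators. With indicators only, this is the definition of independence. *)
suff step k : (k <= n)%N -> forall (F : 'I_n -> R -> R) (m : 'I_n -> R),
    (forall i, measurable_fun setT (F i)) -> (forall i x, 0 <= F i x)%R ->
    (forall i, \int[P]_w (F i (X i w))%:E = (m i)%:E) ->
    (forall i : 'I_n, (k <= i)%N -> exists2 B, measurable B & F i = \1_B) ->
    \int[P]_w (\prod_i F i (X i w))%:E = (\prod_i m i)%:E.
  by move=> mF F0 FE; apply: (step n) => // i; rewrite leqNgt ltn_ord.
elim: k => [_|k IHk kn] {}F {}m mF F0 FE FB.
  have /choice [B BE] : forall i, exists B, measurable B /\ F i = \1_B.
    by move=> i; have [//|B mB ->] := FB i; exists B.
  have mE i : (m i)%:E = P (X i @^-1` B i).
    have [mB FiE] := BE i; rewrite -FE FiE.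
    by rewrite -[RHS]/(P _) -[X in P X]setIT -integral_indic //; exact: mX.
  have := indep [set: 'I_n]%SET B (fun i _ => (BE i).1).
  under [X in _ = X -> _]eq_bigr do rewrite -mE.
  set A := \bigcap_(i in _) _ => PA.
  have mA : measurable A.
    apply: fin_bigcap_measurable => [|i _]; first exact: finite_finset.
    by apply: mX; case: (BE i).
  transitivity (P A).
    rewrite -[X in P X]setIT -integral_indic //.
    apply: eq_integral => w _; congr (_%:E).
    have [AB|] := pselect (forall i, B i (X i w)).
      rewrite big1 ?indicE ?mem_set //; first by move=> i _; exact: AB.
      by move=> i _; rewrite (BE i).2 indicE mem_set.
    move=> /existsNP[i Bi]; rewrite (bigD1 i) //= (BE i).2 !indicE memNset //.
    by rewrite mul0r memNset // => /(_ i); apply: contra_not Bi; apply => /=; rewrite inE.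
  by rewrite PA -prodEFin; apply: eq_bigl => i; rewrite inE.
pose i0 := Ordinal kn.
pose cc := (\prod_(i | i != i0) m i)%R.
have m_ge0 i : (0 <= m i)%R.
  by rewrite -lee_fin -FE integral_ge0 // => w _; rewrite lee_fin.
have mFX i : measurable_fun setT (fun w => F i (X i w)).
  exact: measurableT_comp.
(* The product of the other factors is the weight. The identity for an indicator in position [i0] is
   the induction hypothesis, which frees the factor [F i0]. *)
have := @ge0_integral_density _ _ _ _ _ P (distribution P (X i0))
  (fun w => \prod_(i | i != i0) F i (X i w))%R (X i0) cc (F i0).
rewrite (ge0_integral_distribution (X i0)); last 2 first.
- exact/measurable_EFinP.
- by move=> x; rewrite lee_fin.
rewrite [X in _ -> _ = _ * X](FE i0) -EFinM => h.
rewrite (bigD1 i0) //= mulrC -/cc -h //.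
- by apply: eq_integral => w _; rewrite (bigD1 i0) //= mulrC.
- by under eq_fun do rewrite -big_filter; exact: measurable_prod.
- by move=> w; apply: prodr_ge0.
- by apply: prodr_ge0.
move=> B mB.
pose F' i := if i == i0 then \1_B else F i.
pose m' i := if i == i0 then fine (P (X i0 @^-1` B)) else m i.
have -> : cc%:E * distribution P (X i0) B = (\prod_i m' i)%:E.
  rewrite (bigD1 i0) //= {1}/m' eqxx EFinM fineK ?fin_num_measure //; last exact: mX.
  rewrite muleC; congr (_ * _%:E).
  by apply: eq_bigr => i /negbTE ii0; rewrite /m' ii0.
rewrite -(IHk (ltnW kn) F') //.
- apply: eq_integral => w _; rewrite [in RHS](bigD1 i0) //= {1}/F' eqxx mulrC.
  by congr (_ * _)%:E; apply: eq_bigr => i /negbTE ii0; rewrite /F' ii0.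
- by move=> i; rewrite /F'; case: ifP => // _; exact: measurable_indic.
- by move=> i x; rewrite /F'; case: ifP.
- move=> i; rewrite /F' /m'; case: ifPn => [/eqP ->|_]; last exact: FE.
  rewrite fineK ?fin_num_measure //; last exact: mX.
  by rewrite -[X in P X]setIT -integral_indic //; exact: mX.
- move=> i ki; rewrite /F'; case: eqP => [_|/eqP ii0]; first by exists B.
  apply: FB; rewrite ltn_neqAle ki andbT; apply: contra ii0 => /eqP ki'.
  by apply/eqP/val_inj.
Qed.

End Independence.

(** * One-dimensional Gaussian integrals *)

Section Gaussian.
Local Open Scope classical_set_scope.
Local Open Scope ereal_scope.
Context {R : realType}.
Implicit Types a s c : R.

Lemma integral_normal_prob m s (f : R -> R) :
  measurable_fun setT f -> (forall x, 0 <= f x)%R ->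
  \int[normal_prob m s]_x (f x)%:E =
  \int[lebesgue_measure]_x (normal_pdf m s x * f x)%:E.
Proof.
move=> mf f0; rewrite -[LHS]mul1e -(@ge0_integral_density _ _ _ _ _ lebesgue_measure
  (normal_prob m s) (normal_pdf m s) id 1%R f) //.
- exact: measurable_normal_pdf.
- exact: normal_pdf_ge0.
move=> B mB; rewrite mul1e /normal_prob [RHS]integral_mkcond.
apply: eq_integral => x _ /=; rewrite patchE indicE.
by case: ifP => _; rewrite ?mulr1 ?mulr0.
Qed.

Lemma integral_normal_pdf_expR s a : (0 < s)%R ->
  \int[lebesgue_measure]_x (normal_pdf 0 s x * expR (a * x))%:E =
  (expR (a ^+ 2 * s ^+ 2 / 2))%:E.
Proof.
move=> s0; have sN0 : s != 0%R by rewrite gt_eqF.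
(* Completing the square: the integrand is the constant times the density of mean [a * s ^+ 2]. *)
rewrite -[RHS]mule1 -(integral_normal_pdf (a * s ^+ 2) s) -ge0_integralZl //=.
- apply: eq_integral => x _; rewrite -EFinM !normal_pdfE //; congr (_%:E).
  rewrite mulrCA -!mulrA; congr (_ * _)%R; rewrite /normal_fun -!expRD.
  by congr expR; field.
- by apply/measurable_EFinP; exact: measurable_normal_pdf.
- by move=> x _; rewrite lee_fin normal_pdf_ge0.
Qed.

Lemma integral_normal_pdf_expR_sqr s : (s < 1)%R ->
  \int[lebesgue_measure]_x (normal_pdf 0 1 x * expR (s * x ^+ 2 / 2))%:E =
  ((Num.sqrt (1 - s))^-1)%:E.
Proof.
move=> s1; set r := Num.sqrt (1 - s); have r0 : (0 < r)%R by rewrite sqrtr_gt0 subr_gt0.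
have rN0 : r != 0%R by rewrite gt_eqF.
have r2 : (r ^+ 2 = 1 - s)%R by rewrite sqr_sqrtr // subr_ge0 ltW.
(* The integrand is [r^-1] times the centred density of standard deviation [r^-1]. *)
rewrite -[RHS]mule1 -(integral_normal_pdf 0 r^-1) -ge0_integralZl //=.
- apply: eq_integral => x _; rewrite -EFinM !normal_pdfE ?invr_eq0 ?oner_neq0 //.
  congr (_%:E); rewrite -[LHS]mulrA [RHS]mulrA; congr (_ * _)%R.
    rewrite /normal_peak expr1n mul1r -[(_ * pi *+ 2)%R]mulrnAr sqrtrM ?sqr_ge0 //.
    rewrite sqrtr_sqr gtr0_norm ?invr_gt0 // invfM invrK mulrA mulVf //.
    by rewrite mul1r.
  rewrite /normal_fun -expRD; congr expR; rewrite exprVn r2.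
  by field; rewrite subr_eq0 eq_sym lt_eqF.
- by apply/measurable_EFinP; exact: measurable_normal_pdf.
- by move=> x _; rewrite lee_fin normal_pdf_ge0.
- by rewrite lee_fin invr_ge0 ltW.
Qed.

End Gaussian.

(** * Elementary inequalities for the test function *)

Section RealInequalities.
Context {R : realType}.
Implicit Types a h q x y : R.

Lemma expR_gap a h x :
  expR ((a + h) * x / 2) - expR (a * x / 2) = (expR (h * x / 2) - 1) * expR (a * x / 2).
Proof. by rewrite mulrBl mul1r -expRD; congr (expR _ - _); ring. Qed.

(** Monotonicity of the test function, as Markov's inequality requires; it is a product of two
    nonnegative nondecreasing factors. *)
Lemma expR_gap_le a h x y : 0 <= a -> 0 <= h -> 0 <= x -> x <= y ->
  expR ((a + h) * x / 2) - expR (a * x / 2) <= expR ((a + h) * y / 2) - expR (a * y / 2).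
Proof.
move=> a0 h0 x0 xy; rewrite (expR_gap a h x) (expR_gap a h y); apply: ler_pM.
- by rewrite subr_ge0 -[leLHS]expR0 ler_expR divr_ge0 // mulr_ge0.
- exact: expR_ge0.
- by rewrite lerD2r ler_expR ler_wpM2r // ler_wpM2l.
- by rewrite ler_expR ler_wpM2r // ler_wpM2l.
Qed.

(** Compares the factors [(1 - s)^(-1/2)] and [q = (1 - s - h)^(-1/2)] of two moment generating
    functions; the slope of the inverse square root at [q ^- 2] is [- q ^+ 3 / 2]. *)
Lemma invsqrt_diff q h : 0 < q -> 0 < h ->
  [/\ 0 < (Num.sqrt (q ^- 2 + h))^-1, (Num.sqrt (q ^- 2 + h))^-1 <= q &
      q - (Num.sqrt (q ^- 2 + h))^-1 <= h / 2 * q ^+ 3].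
Proof.
move=> q0 h0; have q2 : 0 < q ^- 2 by rewrite invr_gt0 exprn_gt0.
set a := Num.sqrt _; have a2 : a ^+ 2 = q ^- 2 + h by rewrite sqr_sqrtr // addr_ge0 ?ltW.
have a_gt0 : 0 < a by rewrite sqrtr_gt0 addr_gt0.
have qV : 0 < q^-1 by rewrite invr_gt0.
have qa : q^-1 <= a.
  by rewrite -(@ler_pXn2r _ 2) ?nnegrE ?(ltW qV) ?(ltW a_gt0) // a2 exprVn lerDl ltW.
have le1 : a^-1 <= q by rewrite -[leRHS]invrK lef_pV2 ?posrE.
split => //; first by rewrite invr_gt0.
have diff : q - a^-1 = q * a^-1 * (a - q^-1) by field; rewrite !gt_eqF.
have ub : a - q^-1 <= h / 2 * q.
  have -> : a - q^-1 = h / (a + q^-1).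
    have -> : h = (a - q^-1) * (a + q^-1) by rewrite -subr_sqr a2 exprVn; ring.
    by rewrite mulfK // gt_eqF // addr_gt0.
  rewrite -mulrA ler_wpM2l ?(ltW h0) //.
  rewrite -[X in _ <= _ * X]invrK -invfM lef_pV2 ?posrE ?mulr_gt0 ?addr_gt0 //; lra.
rewrite diff (_ : h / 2 * q ^+ 3 = (q * q) * (h / 2 * q)); last by ring.
apply: ler_pM => //; first by rewrite mulr_ge0 ?invr_ge0 ?ltW.
  by rewrite subr_ge0.
by rewrite ler_wpM2l // ltW.
Qed.

Lemma subrX_le x y n : 0 <= x -> x <= y ->
  y ^+ n - x ^+ n <= n%:R * (y - x) * y ^+ n.-1.
Proof.
move=> x0 xy; have y0 := le_trans x0 xy.
case: n => [|k] /=; first by rewrite !expr0 subrr mul0r mul0r.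
rewrite subrXX [(_%:R * _)]mulrC -[leRHS]mulrA ler_wpM2l ?subr_ge0 //.
have -> : k.+1%:R * y ^+ k = \sum_(i < k.+1) y ^+ k.
  by rewrite sumr_const card_ord mulr_natl.
apply: ler_sum => i _ /=; have ik : (i <= k)%N by rewrite -ltnS.
rewrite -[in leRHS](subnK ik) exprD ler_wpM2l ?exprn_ge0 //.
by rewrite lerXn2r ?nnegrE.
Qed.

End RealInequalities.

(** * Tail of the squared norm along orthonormal directions *)

Section GaussianVector.
Local Open Scope classical_set_scope.
Local Open Scope ereal_scope.
Context {d : measure_display} {T : measurableType d} {R : realType}.
Variables (P : probability T R) (n : nat) (noise : 'I_n -> {RV P >-> R}) (sigma : R).
Hypotheses (sigma_gt0 : (0 < sigma)%R) (noise_iid : iid_normal 0 sigma noise).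

Definition std_noise (w : T) : 'cV[R]_n := (\col_i (noise i w / sigma))%R.

Lemma measurable_dot_noise u : measurable_fun setT (fun w => dot u (std_noise w)).
Proof.
apply: measurable_sum => i; under eq_fun do rewrite mxE.
by apply: measurable_funM => //; exact: measurable_funM.
Qed.

Lemma integral_expR_dot u :
  \int[P]_w (expR (dot u (std_noise w)))%:E = (expR (dot u u / 2))%:E.
Proof.
have [indep law] := noise_iid.
pose F i (x : R) := expR (u i 0%R / sigma * x)%R.
have mF i : measurable_fun setT (F i).
  by apply: measurableT_comp => //; exact: measurable_funM.
have F0 i x : (0 <= F i x)%R by exact: expR_ge0.
rewrite (_ : expR (dot u u / 2) = \prod_i expR ((u i 0%R / sigma) ^+ 2 * sigma ^+ 2 / 2))%R.
  rewrite -(@mutually_independent_integral _ _ _ _ _ noise F) //.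
    apply: eq_integral => w _; congr (_%:E); rewrite /F -expR_sum; congr expR.
    by apply: eq_bigr => i _; rewrite mxE mulrAC mulrA.
  move=> i; transitivity (\int[normal_prob 0 sigma]_y (F i y)%:E).
    have := @ge0_integral_density _ _ _ (measurableTypeR R) _ P (normal_prob 0 sigma)
      (cst 1%R) (noise i) 1%R (F i).
    rewrite mul1e => <- //.
    - by apply: eq_integral => w _; rewrite mul1r.
    - exact: (measurable_funPT (noise i)).
    - move=> B mB; rewrite mul1e; transitivity (distribution P (noise i) B); last exact: law.
      under eq_integral do rewrite mul1r.
      rewrite -[RHS]/(P (noise i @^-1` B)) -[X in P X]setIT -integral_indic //.
      by rewrite -[_ @^-1` _]setTI; exact: measurable_funPT.
    - exact: (mF i).
  rewrite integral_normal_prob //; exact: integral_normal_pdf_expR.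
rewrite -expR_sum mulr_suml; congr expR; apply: eq_bigr => i _.
by field; rewrite gt_eqF.
Qed.

Fixpoint orthonormal (vs : seq 'cV[R]_n) : Prop :=
  if vs is v :: vs' then
    [/\ dot v v = 1%R, forall w, w \in vs' -> dot v w = 0%R & orthonormal vs']
  else True.

Definition sqnorm_on (vs : seq 'cV[R]_n) (x : 'cV[R]_n) : R :=
  (\sum_(v <- vs) dot v x ^+ 2)%R.

Lemma measurable_sqnorm_on vs :
  measurable_fun setT (fun w => sqnorm_on vs (std_noise w)).
Proof.
by apply: measurable_sum => v; apply: measurable_funX; exact: measurable_dot_noise.
Qed.

(* Hubbard-Stratonovich: [expR (s * L ^+ 2 / 2)] is the mean of [expR (sqrt s * g * L)]
   over a standard normal [g], so that only exponentials of linear forms of the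
   noise have to be integrated. *)
Lemma integral_expR_sqnorm_on vs s u : (0 <= s < 1)%R -> orthonormal vs ->
  (forall v, v \in vs -> dot v u = 0%R) ->
  \int[P]_w (expR (dot u (std_noise w) + s * sqnorm_on vs (std_noise w) / 2))%:E =
  (expR (dot u u / 2) * (Num.sqrt (1 - s))^-1 ^+ size vs)%:E.
Proof.
move=> /andP[s0 s1].
(* The linear term [u] is general because each step moves a direction into it: it becomes
   [u + (r * g) *: v], still orthogonal to the remaining vectors. *)
elim: vs u => [u _ _|v vs IH u /= [vv vvs ovs] uvs].
  under eq_integral do rewrite /sqnorm_on big_nil mulr0 mul0r addr0.
  by rewrite integral_expR_dot expr0 mulr1.
pose r := Num.sqrt s; have r2 : (r ^+ 2 = s)%R by rewrite sqr_sqrtr.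
pose h (w : T) (g : R) := (normal_pdf 0 1 g *
  expR (dot (u + (r * g) *: v) (std_noise w) + s * sqnorm_on vs (std_noise w) / 2))%R.
have h_ge0 w g : (0 <= h w g)%R by rewrite mulr_ge0 ?normal_pdf_ge0 ?expR_ge0.
transitivity (\int[P]_w \int[lebesgue_measure]_g (h w g)%:E).
  apply: eq_integral => w _.
  set L := dot v (std_noise w).
  set a := (dot u (std_noise w) + s * sqnorm_on vs (std_noise w) / 2)%R.
  transitivity (\int[lebesgue_measure]_g
      ((expR a)%:E * (normal_pdf 0 1 g * expR (r * L * g))%:E)).
    rewrite ge0_integralZl //=.
    - rewrite integral_normal_pdf_expR // -EFinM; congr (_%:E); rewrite -expRD.
      congr expR; rewrite /sqnorm_on big_cons -/L -/(sqnorm_on _ _) /a.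
      by rewrite exprMn r2 expr1n; ring.
    - apply/measurable_EFinP; apply: measurable_funM; first exact: measurable_normal_pdf.
      by apply: measurableT_comp => //; exact: measurable_funM.
    - by move=> g _; rewrite lee_fin mulr_ge0 ?normal_pdf_ge0 ?expR_ge0.
  apply: eq_integral => g _; rewrite -EFinM mulrCA -expRD; congr (_ * expR _)%:E.
  by rewrite dotDl dotZl -/L /a; ring.
have mh : measurable_fun setT (fun z : T * R => (h z.1 z.2)%:E).
  apply/measurable_EFinP; apply: measurable_funM.
    by apply: (measurableT_comp (measurable_normal_pdf 0 1)) => //; exact: measurable_snd.
  apply: measurableT_comp => //; apply: measurable_funD.
    under eq_fun do rewrite dotDl dotZl.
    apply: measurable_funD.
      exact: (measurableT_comp (measurable_dot_noise u) measurable_fst).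
    apply: measurable_funM.
      by apply: measurable_funM => //; exact: measurable_snd.
    exact: (measurableT_comp (measurable_dot_noise v) measurable_fst).
  apply: measurable_funM => //; apply: measurable_funM => //.
  exact: (measurableT_comp (measurable_sqnorm_on vs) measurable_fst).
transitivity (\int[lebesgue_measure]_g \int[P]_w (h w g)%:E).
  have := @fubini_tonelli _ _ T (measurableTypeR R) R P lebesgue_measure
    (fun z : T * R => (h z.1 z.2)%:E).
  apply => //.
  by move=> z; rewrite lee_fin.
set q := ((Num.sqrt (1 - s))^-1)%R.
have inner g : \int[P]_w (h w g)%:E =
    (expR (dot u u / 2) * q ^+ size vs)%:E * (normal_pdf 0 1 g * expR (s * g ^+ 2 / 2))%:E.
  rewrite /h; under eq_integral do rewrite EFinM.
  rewrite ge0_integralZl //=.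
  - rewrite IH //.
      rewrite -!EFinM; congr (_%:E).
      have -> : (dot (u + (r * g) *: v) (u + (r * g) *: v) = dot u u + s * g ^+ 2)%R.
        rewrite !dotDl !dotDr !dotZl !dotZr vv (dotC u v) (uvs v) ?mem_head //.
        by rewrite -r2; ring.
      by rewrite mulrDl expRD -/q; ring.
    move=> w wvs; rewrite dotDr dotZr dotC (dotC w) vvs // mulr0 addr0 dotC.
    by apply: uvs; rewrite in_cons wvs orbT.
  - apply/measurable_EFinP; apply: measurableT_comp => //; apply: measurable_funD.
      exact: measurable_dot_noise.
    apply: measurable_funM => //; apply: measurable_funM => //.
    exact: measurable_sqnorm_on.
  - by rewrite lee_fin normal_pdf_ge0.
under eq_integral do rewrite inner.
rewrite ge0_integralZl //=.
- by rewrite integral_normal_pdf_expR_sqr // -EFinM exprSr mulrA.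
- apply/measurable_EFinP; apply: measurable_funM; first exact: measurable_normal_pdf.
  apply: measurableT_comp => //; apply: measurable_funM => //.
  by apply: measurable_funM => //; exact: measurable_funX.
- by move=> g _; rewrite lee_fin mulr_ge0 ?normal_pdf_ge0 ?expR_ge0.
- by rewrite lee_fin mulr_ge0 ?expR_ge0 // exprn_ge0 // invr_ge0 sqrtr_ge0.
Qed.

Lemma measurable_sqnorm_on_ge vs w0 :
  measurable [set w | w0 <= sqnorm_on vs (std_noise w)]%R.
Proof.
rewrite (_ : [set w | _] = (fun w => sqnorm_on vs (std_noise w)) @^-1` `[w0, +oo[).
  by rewrite -[_ @^-1` _]setTI; exact: measurable_sqnorm_on.
by apply/seteqP; split => w; rewrite /= in_itv /= andbT.
Qed.

(* Markov's inequality for the test function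
   [expR ((s + h) * W / 2) - expR (s * W / 2)]; as [h] tends to 0 this amounts to
   the test function [W * expR (s * W / 2)], which loses less than [expR (s * W / 2)]. *)
Lemma tail_sqnorm_on_step vs w0 q s h : orthonormal vs -> (0 < w0 -> 0 < q ->
  0 <= s -> 0 < h -> s + h + q ^- 2 = 1 ->
  fine (P [set w | w0 <= sqnorm_on vs (std_noise w)]) * w0 * expR (s * w0 / 2) <=
  (size vs)%:R * q ^+ (size vs).+2)%R.
Proof.
move=> ovs w0_gt0 q0 s_ge0 h_gt0 shq; set A := [set w | _].
pose W w := sqnorm_on vs (std_noise w).
have W_ge0 w : (0 <= W w)%R by apply: sumr_ge0 => v _; rewrite sqr_ge0.
have mW : measurable_fun setT W by exact: measurable_sqnorm_on.
have mA : measurable A by exact: measurable_sqnorm_on_ge.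
have mgf a : (0 <= a < 1)%R ->
    \int[P]_w (expR (a * W w / 2))%:E = ((Num.sqrt (1 - a))^-1 ^+ size vs)%:E.
  move=> a01; have := @integral_expR_sqnorm_on vs a 0 a01 ovs.
  rewrite dot0l mul0r expR0 mul1r => <-; last by move=> v _; rewrite dotC dot0l.
  by apply: eq_integral => w _; rewrite dot0l add0r.
have mexp a : measurable_fun setT (fun w => (expR (a * W w / 2))%:E).
  apply/measurable_EFinP; apply: measurableT_comp => //; apply: measurable_funM => //.
  exact: measurable_funM.
have qV_gt0 : (0 < q ^- 2)%R by rewrite invr_gt0 exprn_gt0.
have sh_ge0 : (0 <= s + h)%R by rewrite addr_ge0 // ltW.
pose D := (expR ((s + h) * w0 / 2) - expR (s * w0 / 2))%R.
(* The factor [h] here cancels against the one in [invsqrt_diff], so the estimate survives as [h]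
   tends to 0. *)
have D_ge : (h * w0 / 2 * expR (s * w0 / 2) <= D)%R.
  rewrite /D expR_gap ler_wpM2r ?expR_ge0 // lerBrDl; exact: expR_ge1Dx.
have D_ge0 : (0 <= D)%R.
  by apply: le_trans D_ge; rewrite mulr_ge0 ?expR_ge0 // divr_ge0 // mulr_ge0 // ltW.
have pointwise w : (D * \1_A w + expR (s * W w / 2) <= expR ((s + h) * W w / 2))%R.
  rewrite indicE; case: (boolP (w \in A)); last first.
    move=> _; rewrite mulr0 add0r ler_expR ler_wpM2r // ler_wpM2r //.
    by rewrite lerDl ltW.
  rewrite inE => Aw; rewrite mulr1 -lerBrDr.
  by apply: expR_gap_le => //; exact: ltW.
have PA : P A \is a fin_num by exact: fin_num_measure.
have [q'_gt0 q'_le q'_diff] := invsqrt_diff q0 h_gt0.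
(* Integrates [pointwise]: since [1 - (s + h) = q ^- 2] and [1 - s = q ^- 2 + h], the two moment
   generating functions are the powers of [q] and of the inverse square root. *)
have main : (D * fine (P A) + (Num.sqrt (q ^- 2 + h))^-1 ^+ size vs <= q ^+ size vs)%R.
  have -> : (q ^+ size vs = (Num.sqrt (1 - (s + h)))^-1 ^+ size vs)%R.
    rewrite -shq addrAC subrr add0r -exprVn sqrtr_sqr gtr0_norm ?invr_gt0 //.
    by rewrite invrK.
  have -> : (q ^- 2 + h = 1 - s)%R by rewrite -shq; ring.
  rewrite -lee_fin EFinD EFinM fineK // -!mgf; last 2 first.
  - by rewrite sh_ge0 /=; lra.
  - by rewrite s_ge0 /=; lra.
  rewrite -[X in P X]setIT -integral_indic // -ge0_integralZl //; last first.
    exact/measurable_EFinP.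
  rewrite -ge0_integralD //; last first.
  - by apply: measurable_funeM; exact/measurable_EFinP.
  - by move=> w _; rewrite -EFinM lee_fin mulr_ge0.
  apply: ge0_le_integral => //.
  - by move=> w _; rewrite adde_ge0 // -?EFinM lee_fin ?mulr_ge0.
  - by apply: emeasurable_funD => //; apply: measurable_funeM; exact/measurable_EFinP.
  - by move=> w _; rewrite -EFinM -EFinD lee_fin pointwise.
move: (Num.sqrt (q ^- 2 + h))^-1%R q'_gt0 q'_le q'_diff main => q' q'_gt0 q'_le q'_diff main.
have {}main : (D * fine (P A) <= (size vs)%:R * (q - q') * q ^+ (size vs).-1)%R.
  rewrite -lerBrDr in main; apply: (le_trans main).
  by apply: subrX_le => //; exact: ltW.
have PA0 : (0 <= fine (P A))%R by rewrite fine_ge0.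
have hw0 : (0 < h / 2)%R by rewrite divr_gt0.
rewrite -(ler_pM2l hw0).
have -> : (h / 2 * (fine (P A) * w0 * expR (s * w0 / 2)) =
   h * w0 / 2 * expR (s * w0 / 2) * fine (P A))%R by ring.
apply: le_trans (le_trans main _); first by rewrite ler_wpM2r.
have -> : (h / 2 * ((size vs)%:R * q ^+ (size vs).+2) =
    (size vs)%:R * (h / 2 * q ^+ (size vs).+2))%R by ring.
case: (size vs) => [|k] /=; first by rewrite !mul0r.
rewrite -[leLHS]mulrA ler_wpM2l //.
have -> : (h / 2 * q ^+ k.+3 = h / 2 * q ^+ 3 * q ^+ k)%R.
  by rewrite -[RHS]mulrA -exprD.
by rewrite ler_wpM2r // exprn_ge0 // ltW.
Qed.

Lemma tail_sqnorm_on vs w0 q m : orthonormal vs -> (size vs <= m)%N ->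
  (0 < w0)%R -> (1 < q)%R ->
  P [set w | w0 <= sqnorm_on vs (std_noise w)]%R <=
  (m%:R / w0 * q ^+ m.+2 * expR (- ((1 - q ^- 2) * w0 / 2)))%:E.
Proof.
move=> ovs vsm w0_gt0 q_gt1; set A := [set w | _].
have q0 : (0 < q)%R by rewrite (lt_trans ltr01).
have PA : P A \is a fin_num.
  by apply: fin_num_measure; exact: measurable_sqnorm_on_ge.
rewrite -(fineK PA) lee_fin; set s1 := (1 - q ^- 2)%R.
have s1_gt0 : (0 < s1)%R.
  by rewrite subr_gt0 invf_lt1 ?exprn_gt0 // exprn_egt1.
pose K := (fine (P A) * w0 * expR (s1 * w0 / 2))%R.
have -> : (m%:R / w0 * q ^+ m.+2 * expR (- (s1 * w0 / 2)) =
    m%:R * q ^+ m.+2 / (w0 * expR (s1 * w0 / 2)))%R.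
  by rewrite expRN; field; rewrite !gt_eqF ?expR_gt0.
rewrite ler_pdivlMr ?mulr_gt0 ?expR_gt0 // mulrA -subr_le0.
(* The previous lemma is used with [s + h = s1] fixed and [h = t * s1 / 2]; the loss
   [expR (- t * s1 * w0 / 4)] is at least [1 - t * s1 * w0 / 4] and disappears as [t] tends to 0. *)
apply: (@le0_of_small _ _ (K * (s1 * w0 / 4))) => t t0 t1.
have h_gt0 : (0 < t * s1 / 2)%R by rewrite divr_gt0 // mulr_gt0.
have h_lt : (t * s1 / 2 < s1)%R.
  rewrite ltr_pdivrMr // mulrC ltr_pM2l //; lra.
have shq : (s1 - t * s1 / 2 + t * s1 / 2 + q ^- 2 = 1)%R by rewrite subrK subrK.
have sh_ge0 : (0 <= s1 - t * s1 / 2)%R by rewrite subr_ge0 ltW.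
have := tail_sqnorm_on_step ovs w0_gt0 q0 sh_ge0 h_gt0 shq; rewrite -/A.
have -> : (expR ((s1 - t * s1 / 2) * w0 / 2) =
    expR (s1 * w0 / 2) * expR (- (t * s1 * w0 / 4)))%R.
  by rewrite -expRD; congr expR; field.
rewrite mulrA -/K => le_size.
have K_ge0 : (0 <= K)%R.
  by rewrite mulr_ge0 ?expR_ge0 // mulr_ge0 ?fine_ge0 // ltW.
have : (K * (1 - t * s1 * w0 / 4) <= (size vs)%:R * q ^+ (size vs).+2)%R.
  by apply: le_trans le_size; rewrite ler_wpM2l // expR_ge1Dx.
have : ((size vs)%:R * q ^+ (size vs).+2 <= m%:R * q ^+ m.+2)%R.
  apply: ler_pM; rewrite ?ler_nat // ?exprn_ge0 ?(ltW q0) //.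
  by rewrite ler_weXn2l // ltW.
have -> : (t * (K * (s1 * w0 / 4)) = K * (t * s1 * w0 / 4))%R by ring.
rewrite mulrBr mulr1; lra.
Qed.

End GaussianVector.

(** * Union bound over the groups *)

Section GramSchmidt.
Context {R : realType} {n : nat}.
Implicit Types (u v w x : 'cV[R]_n) (us vs : seq 'cV[R]_n).

Lemma dot_orthonormal vs w (F : 'cV[R]_n -> R) : orthonormal vs -> w \in vs ->
  dot w (\sum_(v <- vs) F v *: v) = F w.
Proof.
elim: vs => // v vs IH /= [vv vvs ovs]; rewrite in_cons big_cons dotDr dotZr.
case/predU1P => [->|wvs]; last by rewrite dotC vvs // mulr0 add0r IH.
rewrite vv mulr1 dot_sumr big_seq big1 ?addr0 // => w' w'vs.
by rewrite dotZr vvs // mulr0.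
Qed.

(** A vector with zero residual adds nothing; otherwise its normalised residual is put in front. *)
Lemma gram_schmidt us : exists vs, [/\ (size vs <= size us)%N, orthonormal vs &
  forall u, u \in us -> u = \sum_(v <- vs) dot v u *: v].
Proof.
elim: us => [|u us [vs [vs_us ovs span]]]; first by exists [::].
pose r := u - \sum_(v <- vs) dot v u *: v.
have rvs v : v \in vs -> dot r v = 0.
  by move=> vvs; rewrite dotC dotBr dot_orthonormal // subrr.
have [r0|rN0] := eqVneq (dot r r) 0.
  exists vs; split => //; first exact: leqW.
  move=> w; rewrite in_cons => /predU1P[->|]; last exact: span.
  by apply/eqP; rewrite -subr_eq0; apply/eqP/dot_eq0.
have rr_gt0 : 0 < dot r r by rewrite lt_neqAle eq_sym rN0 dot_ge0.
pose a := (Num.sqrt (dot r r))^-1; have a2 : a ^+ 2 * dot r r = 1.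
  by rewrite exprVn sqr_sqrtr ?mulVf // dot_ge0.
exists (a *: r :: vs); split => //=.
  split => //; first by rewrite dotZl dotZr mulrA -expr2.
  by move=> w wvs; rewrite dotZl rvs // mulr0.
have dot_r (w : 'cV[R]_n) (F : 'cV[R]_n -> R) : dot r (\sum_(v <- vs) F v *: v) = 0.
  rewrite dot_sumr big_seq big1 // => v vvs; by rewrite dotZr rvs // mulr0.
move=> w; rewrite in_cons big_cons => /predU1P[->|wus].
  have -> : dot (a *: r) u *: (a *: r) = r.
    have ru : dot r u = dot r r.
      have -> : u = r + \sum_(v <- vs) dot v u *: v by rewrite subrK.
      by rewrite dotDr dot_r // addr0.
    by rewrite dotZl ru scalerA mulrAC -expr2 a2 scale1r.
  by rewrite subrK.
rewrite {2}(span w wus) dotZl dot_r // mulr0 scale0r add0r; exact: span.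
Qed.

(** For [y] the projection of [x], [dot y y] equals both the sum of [dot v y ^+ 2] and that of
    [dot v y * dot v x]. Expanding the sum of [(dot v x - dot v y) ^+ 2] then gives the
    inequality. *)
Lemma orthoproj_sqnorm_on m (A : 'M[R]_(n, m)) :
  exists vs, [/\ (size vs <= m)%N, orthonormal vs & forall x,
    dot (orthoproj A *m x) (orthoproj A *m x) <= sqnorm_on vs x].
Proof.
have [vs [vs_m ovs span]] := gram_schmidt [seq col j A | j <- enum 'I_m].
exists vs; split => //; first by rewrite size_map size_enum_ord in vs_m.
move=> x; have [[b Ab] _] := orthoprojP A x.
set y := orthoproj A *m x in Ab *.
have yE : y = \sum_(v <- vs) dot v y *: v.
  have -> : y = \sum_j b j 0 *: col j A.
    rewrite Ab; apply/colP => i; rewrite !mxE summxE.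
    by apply: eq_bigr => j _; rewrite !mxE mulrC.
  rewrite [in LHS](eq_bigr (fun j => \sum_(v <- vs) (b j 0 * dot v (col j A)) *: v)).
    rewrite exchange_big; apply: eq_bigr => v _ /=; rewrite dot_sumr scaler_suml.
    by apply: eq_bigr => j _; rewrite dotZr.
  move=> j _; have jA : col j A \in [seq col j A | j <- enum 'I_m].
    by apply/mapP; exists j; rewrite ?mem_enum.
  rewrite [in LHS](span _ jA).
  by rewrite scaler_sumr; apply: eq_bigr => v _; rewrite scalerA.
have yy : dot y y = \sum_(v <- vs) dot v y * dot v y.
  rewrite {2}yE dot_sumr; apply: eq_bigr => v _; by rewrite dotZr [dot y v]dotC.
have yx : dot y y = \sum_(v <- vs) dot v y * dot v x.
  transitivity (dot x y); first by rewrite {2 3}Ab dot_orthoproj.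
  rewrite {1}yE dot_sumr; apply: eq_bigr => v _; by rewrite dotZr [dot x v]dotC.
have : 0 <= \sum_(v <- vs) (dot v x - dot v y) ^+ 2.
  by apply: sumr_ge0 => v _; rewrite sqr_ge0.
have -> : \sum_(v <- vs) (dot v x - dot v y) ^+ 2 = sqnorm_on vs x - dot y y.
  have -> : sqnorm_on vs x - dot y y = sqnorm_on vs x - 2 * dot y y + dot y y by ring.
  rewrite {1}yx {1}yy mulr_sumr /sqnorm_on -sumrB -big_split.
  by apply: eq_bigr => v _ /=; ring.
by rewrite subr_ge0.
Qed.

End GramSchmidt.

(** * Tail of the projected noise *)

Section NoiseControl.
Local Open Scope classical_set_scope.
Local Open Scope ereal_scope.
Context {d : measure_display} {T : measurableType d} {R : realType}.
Variables (P : probability T R) (n : nat) (noise : 'I_n -> {RV P >-> R}) (sigma : R).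
Hypotheses (sigma_gt0 : (0 < sigma)%R) (noise_iid : iid_normal 0 sigma noise).

Lemma Boole_seq (I : Type) (r : seq I) (B : I -> set T) :
  (forall i, measurable (B i)) ->
  P (\big[setU/set0]_(i <- r) B i) <= \sum_(i <- r) P (B i).
Proof.
move=> mB; elim: r => [|i r IH]; first by rewrite !big_nil measure0.
rewrite !big_cons; apply: (@le_trans _ _ (P (B i) + P (\big[setU/set0]_(j <- r) B j))).
  by apply: measureU2 => //; exact: bigsetU_measurable.
by rewrite leeD2l.
Qed.

Lemma measurable_orthoproj_noise m (A : 'M[R]_(n, m)) (x : R) :
  let Z := std_noise noise sigma in
  measurable [set w | dot (orthoproj A *m Z w) (orthoproj A *m Z w) <= x]%R.
Proof.
move=> Z; have mf : measurable_fun setT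
    (fun w => dot (orthoproj A *m Z w) (orthoproj A *m Z w)).
  apply: measurable_sum => i; rewrite (_ : (fun w => _) =
    (fun w => dot (row i (orthoproj A))^T (Z w) * dot (row i (orthoproj A))^T (Z w))%R).
    by apply: measurable_funM; exact: measurable_dot_noise.
  apply/funext => w; rewrite mxE; congr (_ * _)%R;
    by apply: eq_bigr => j _; rewrite !mxE.
rewrite (_ : [set w | _] =
  (fun w => dot (orthoproj A *m Z w) (orthoproj A *m Z w)) @^-1` `]-oo, x]).
  by rewrite -[_ @^-1` _]setTI; exact: mf.
by apply/seteqP; split => w; rewrite /= in_itv.
Qed.

Lemma orthoproj_noise_tail m (A : 'M[R]_(n, m)) (D : nat) (t : R) :
  let Z := std_noise noise sigma in (0 < m <= D)%N -> (1 <= t)%R ->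
  P [set w | (Num.sqrt D%:R + t) ^+ 2 < dot (orthoproj A *m Z w) (orthoproj A *m Z w)]%R
  <= (chi_tail m (Num.sqrt D%:R + t))%:E.
Proof.
move=> Z /andP[m0 mD] t1; set x := (Num.sqrt D%:R + t)%R.
have [vs [vs_m ovs proj_le]] := orthoproj_sqnorm_on A.
have D0 : (0 <= Num.sqrt D%:R :> R)%R by rewrite sqrtr_ge0.
have x0 : (0 < x)%R by rewrite /x; lra.
have b0 : (0 < Num.sqrt m.+2%:R :> R)%R by rewrite sqrtr_gt0.
(* As [D >= m], [D >= 1] and [t >= 1], [x ^ 2 = D + 2 t sqrt D + t ^ 2] is at least [m + 3]. *)
have q1 : (1 < x / Num.sqrt m.+2%:R)%R.
  rewrite ltr_pdivlMr // mul1r -(@ltr_pXn2r _ 2) ?nnegrE ?(ltW x0) ?(ltW b0) //.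
  rewrite sqr_sqrtr // /x sqrrD sqr_sqrtr //.
  have D1 : (1 <= Num.sqrt D%:R :> R)%R.
    by rewrite -(@ler_pXn2r _ 2) ?nnegrE // expr1n sqr_sqrtr // ler1n (leq_trans m0).
  have mDR : (m%:R <= D%:R :> R)%R by rewrite ler_nat.
  rewrite -addn2 natrD.
  have : (1 <= Num.sqrt D%:R * t)%R by rewrite -[leLHS]mulr1; apply: ler_pM.
  have : (1 <= t ^+ 2)%R by rewrite expr_ge1 //; lra.
  lra.
apply: le_trans (tail_sqnorm_on sigma_gt0 noise_iid ovs vs_m _ q1); last by rewrite exprn_gt0.
apply: le_measure; rewrite ?inE.
- rewrite (_ : [set w | _] =
    ~` [set w | dot (orthoproj A *m Z w) (orthoproj A *m Z w) <= x ^+ 2]%R).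
    by apply: measurableC; exact: measurable_orthoproj_noise.
  by apply/seteqP; split => w /=; rewrite ltNge => /negP.
- exact: measurable_sqnorm_on_ge.
- by move=> w /= xlt; apply: le_trans (proj_le _); exact: ltW.
Qed.

End NoiseControl.

(** * Total over the levels of one component *)

Section FarSum.
Context {R : realType}.

Lemma sum_far_bound a i :
  \sum_(a <= j < a + i) far_bound j + far_tail (a + i) <= far_tail a :> R.
Proof.
elim: i => [|i IH]; first by rewrite addn0 big_geq // add0r.
rewrite addnS big_nat_recr ?leq_addr //= -addrA.
by apply: le_trans IH; rewrite lerD2l far_tailS.
Qed.

(** The shift [k.-1] is there because above [kmin] a group of level [k] has size [2 ^ (k - 1)],
    while its penalty level involves [2 ^ k]. *)
Definition level_bound (kmin k : nat) : R :=
  if (k == kmin)%N then near_bound kmin else far_bound k.-1.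

Lemma sum_level_bound kmin kmax : (kmin <= kmax)%N ->
  \sum_(kmin <= k < kmax.+1) level_bound kmin k <= 1.
Proof.
move=> kk; rewrite big_ltn ?ltnS // /level_bound eqxx.
apply: le_trans (near_far_le1 kmin); rewrite lerD2l.
have -> : kmax.+1 = (kmin + (kmax - kmin)).+1 by rewrite subnKC.
rewrite big_add1 /= big_nat_cond [X in X <= _](eq_bigr (fun j => far_bound j)).
  rewrite -big_nat_cond; apply: le_trans (sum_far_bound kmin (kmax - kmin)).
  by rewrite lerDl far_tail_ge0.
by move=> j /andP[/andP[kj _] _]; rewrite gtn_eqF.
Qed.

End FarSum.

(** * Total over all groups *)

Section MultiResolutionTail.
Context {R : realType} {p : nat}.
Variables (J0 J1 : {set 'I_p}) (kmin kmax : nat) (dstar : 'I_p -> nat).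
Hypotheses (J01_disj : [disjoint J0 & J1]) (k_le : (kmin <= kmax)%N).
Hypothesis dstar_gt0 : forall j, j \in J0 -> (0 < dstar j)%N.

Definition group_bound (jk : 'I_p * 'I_kmax.+1) : R :=
  if jk.1 \in J0 then 1 else level_bound kmin jk.2.

(** Each component contributes at most 1: a parametric one has a single group, and the levels of a
    nonparametric one are summed by [sum_level_bound]. *)
Lemma sum_group_bound : \sum_(g : grp J0 J1 kmin kmax) group_bound (val g) <= p%:R.
Proof.
rewrite -(big_sub (Kstar J0 J1 kmin kmax) group_bound) /=.
rewrite (eq_bigl (fun jk : 'I_p * 'I_kmax.+1 => true && ((jk.1, jk.2) \in Kstar J0 J1 kmin kmax)));
  last by case.
rewrite -(pair_big_dep predT (fun j k => (j, k) \in Kstar J0 J1 kmin kmax)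
  (fun j k => group_bound (j, k))) /=.
apply: le_trans (_ : \sum_(j < p) 1 <= _); last by rewrite sumr_const card_ord.
apply: ler_sum => j _; rewrite /group_bound /=.
have [jJ0|jJ0] := boolP (j \in J0).
  have jJ1 : j \in J1 = false by apply: (disjointFr J01_disj).
  have kk : (kmin < kmax.+1)%N by rewrite ltnS.
  rewrite (big_pred1 (Ordinal kk)) // => k.
  by rewrite inE /= jJ0 jJ1 orbF.
have [jJ1|jJ1] := boolP (j \in J1); last first.
  by rewrite big_pred0 ?ler01 // => k; rewrite inE /= (negbTE jJ0) (negbTE jJ1).
apply: le_trans (sum_level_bound k_le).
rewrite big_geq_mkord le_eqVlt; apply/orP; left; apply/eqP/eq_bigl => k.
by rewrite inE /= (negbTE jJ0) jJ1 /= -[(k <= kmax)%N]ltnS ltn_ord andbT.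
Qed.

(** The size equals [D] for parametric groups and at level [kmin], where the near bounds apply; at
    higher levels [D] is twice the size and the far bounds apply. *)
Lemma group_tail (g : grp J0 J1 kmin kmax) (t : R) : 1 <= t ->
  let D := (if gcomp g \in J0 then dstar (gcomp g) else 2 ^ glevel g)%N in
  (0 < gsize dstar g <= D)%N /\
  t * expR (t ^+ 2 / 2) * chi_tail (gsize dstar g) (Num.sqrt D%:R + t) <=
  group_bound (val g).
Proof.
move=> t1 D; rewrite /D /gsize /group_bound -/(gcomp g).
have [gJ0|gJ0] := boolP (gcomp g \in J0).
  by rewrite dstar_gt0 // leqnn; split => //; apply: chi_tail_near1 => //; exact: dstar_gt0.
have kg : (kmin <= glevel g)%N.
  have := valP g; rewrite inE -/(gcomp g) (negbTE gJ0) /= => /andP[_ /andP[]] //.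
rewrite -/(glevel g) expn_gt0 /= leq_exp2l // /level_bound.
have [kgE|kgN] := eqVneq (glevel g) kmin.
  rewrite kgE (maxn_idPr _) ?leq_subr //; split => //; exact: chi_tail_near_pow.
have kg' : (kmin < glevel g)%N by rewrite ltn_neqAle eq_sym kgN.
have -> : maxn (glevel g - 1) kmin = (glevel g).-1.
  by rewrite subn1; apply/maxn_idPl; rewrite -ltnS prednK // (leq_ltn_trans _ kg').
split; first exact: leq_pred.
have {2}-> : glevel g = (glevel g).-1.+1 by rewrite prednK // (leq_ltn_trans _ kg').
exact: chi_tail_far_pow.
Qed.

End MultiResolutionTail.

(** * Probability of noise control *)

Section NoiseControlled.
Context {R : realType} {n p : nat}.
Variables (J0 J1 : {set 'I_p}) (kmin kmax : nat) (dstar : 'I_p -> nat).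
Hypotheses (n_gt0 : (0 < n)%N) (p_gt0 : (0 < p)%N).
Hypotheses (J01_disj : [disjoint J0 & J1]) (k_le : (kmin <= kmax)%N).
Hypothesis dstar_gt0 : forall j, j \in J0 -> (0 < dstar j)%N.
Variable U : forall g : grp J0 J1 kmin kmax, 'M[R]_(n, gsize dstar g).
Context {d : measure_display} {T : measurableType d}.
Variables (P : probability T R) (fstar : 'cV[R]_n) (y : T -> 'cV[R]_n).
Variables (noise : 'I_n -> {RV P >-> R}) (sigma eps : R).
Hypothesis noiseE : forall omega i, ((y omega - fstar) i 0 = noise i omega)%R.
Hypotheses (sigma_gt0 : (0 < sigma)%R) (noise_iid : iid_normal 0 sigma noise).
Hypotheses (eps_gt0 : (0 < eps)%R) (log_ge : (1 <= 2 * ln (p%:R / eps))%R).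
Variable lam : grp J0 J1 kmin kmax -> R.
Hypothesis lamE : forall g, lam g = lambda_univ n dstar sigma eps g.
Local Open Scope classical_set_scope.
Local Open Scope ereal_scope.

Let t : R := Num.sqrt (2 * ln (p%:R / eps)).
Let Z := std_noise noise sigma.
Let D (g : grp J0 J1 kmin kmax) : nat :=
  if gcomp g \in J0 then dstar (gcomp g) else (2 ^ glevel g)%N.

Lemma norm2n_noise_le g w :
  (norm2n (orthoproj (U g) *m (y w - fstar)) <= lam g)%R =
  (dot (orthoproj (U g) *m Z w) (orthoproj (U g) *m Z w) <= (Num.sqrt (D g)%:R + t) ^+ 2)%R.
Proof.
have -> : (y w - fstar = sigma *: Z w)%R.
  by apply/colP => i; rewrite noiseE !mxE mulrCA divff ?mulr1 // gt_eqF.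
have n0 : (0 < Num.sqrt n%:R :> R)%R by rewrite sqrtr_gt0 ltr0n.
have -> : lam g = (sigma * ((Num.sqrt (D g)%:R + t) / Num.sqrt n%:R))%R.
  have sqrtDn : Num.sqrt ((D g)%:R / n%:R) = (Num.sqrt (D g)%:R / Num.sqrt n%:R : R)%R.
    by rewrite sqrtrM ?ler0n // sqrtrV ?ler0n.
  have sqrttn : Num.sqrt (2 / n%:R * ln (p%:R / eps)) = (t / Num.sqrt n%:R)%R.
    by rewrite mulrAC sqrtrM ?sqrtrV ?ler0n // (le_trans ler01).
  by rewrite lamE /lambda_univ -/(D g) sqrtDn sqrttn -mulrDl.
rewrite -scalemxAr norm2nZ gtr0_norm // ler_pM2l // ler_pdivlMr //.
rewrite -(@ler_pXn2r _ 2) ?nnegrE ?mulr_ge0 ?norm2n_ge0 ?addr_ge0 ?sqrtr_ge0 //.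
by rewrite exprMn norm2n_sqr sqr_sqrtr ?ler0n // divfK // pnatr_eq0 -lt0n.
Qed.

Lemma noise_controlled_prob :
  (1 - eps / t)%:E <= P [set w | noise_controlled U lam (y w) fstar].
Proof.
have t1 : (1 <= t)%R by rewrite -(@sqrtr1 R) ler_wsqrtr.
have t_gt0 : (0 < t)%R by exact: lt_le_trans t1.
have e_t : (expR (t ^+ 2 / 2) = p%:R / eps)%R.
  have pe : (0 < p%:R / eps)%R by rewrite divr_gt0 ?ltr0n.
  rewrite sqr_sqrtr ?(le_trans ler01) // mulrC mulKf ?lnK ?posrE //.
pose G g := [set w | dot (orthoproj (U g) *m Z w) (orthoproj (U g) *m Z w) <=
  (Num.sqrt (D g)%:R + t) ^+ 2]%R.
have mG g : measurable (G g) by exact: measurable_orthoproj_noise.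
(* Written as the complement of a finite union, the event is measurable and open to the union
   bound. *)
have -> : [set w | noise_controlled U lam (y w) fstar] =
    ~` \bigcup_(g in [set` index_enum (grp J0 J1 kmin kmax)]) ~` G g.
  apply/seteqP; split => [w /= ctrl [g _] Gg|w /= Gw g].
    by apply: Gg; rewrite /G /= -norm2n_noise_le; exact: ctrl.
  rewrite norm2n_noise_le; apply: contrapT => Gg; apply: Gw.
  by exists g => //=; rewrite mem_index_enum.
rewrite bigcup_seq; set B := \big[_/_]_(_ <- _) _.
have mB : measurable B by apply: bigsetU_measurable => g _; exact: measurableC.
rewrite probability_setC // EFinB leeB //.
apply: (@le_trans _ _ (\sum_(g : grp J0 J1 kmin kmax) P (~` G g))).
  by apply: Boole_seq => g; exact: measurableC.
(* Since [expR (t ^+ 2 / 2) = p / eps], dividing the normalised bound by [t * expR (t ^+ 2 / 2)]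
   gives the factor [eps / (p * t)]; the group bounds then sum to at most [p]. *)
have tail g : P (~` G g) <= (group_bound J0 kmin (val g) * (eps / (p%:R * t)))%:E.
  have [mD bound] := group_tail dstar_gt0 g t1.
  apply: le_trans (_ : (chi_tail (gsize dstar g) (Num.sqrt (D g)%:R + t))%:E <= _).
    have := orthoproj_noise_tail sigma_gt0 noise_iid (U g) mD t1.
    congr (_ <= _); congr (P _); apply/seteqP; split => w /=; rewrite ltNge => /negP //.
  rewrite lee_fin; move: bound; rewrite e_t mulrC => bound.
  have -> : (eps / (p%:R * t) = (t * (p%:R / eps))^-1)%R.
    by field; rewrite pnatr_eq0 -lt0n p_gt0 !gt_eqF.
  by rewrite ler_pdivlMr // mulr_gt0 // divr_gt0 // ltr0n.
apply: le_trans (lee_sum _ (fun g _ => tail g)) _.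
rewrite sumEFin lee_fin -mulr_suml.
apply: le_trans (ler_wpM2r _ (sum_group_bound J01_disj k_le)) _.
  by rewrite divr_ge0 ?mulr_ge0 ?ler0n ?ltW.
have -> : (p%:R * (eps / (p%:R * t)) = eps / t)%R.
  by field; rewrite pnatr_eq0 -lt0n p_gt0 gt_eqF.
by [].
Qed.

End NoiseControlled.

Theorem theorem1 (R : realType) (n p : nat) (n_gt0 : (0 < n)%N) (p_gt0 : (0 < p)%N)
    (J0 J1 : {set 'I_p}) (J01_disj : [disjoint J0 & J1])
    (J01_cover : J0 :|: J1 = [set: 'I_p])
    (kmin kmax : nat) (k_le : (kmin <= kmax)%N)
    (dstar : 'I_p -> nat) (dstar_gt0 : forall j, j \in J0 -> (0 < dstar j)%N)
    (U : forall g : grp J0 J1 kmin kmax, 'M[R]_(n, gsize dstar g))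
    (lam : grp J0 J1 kmin kmax -> R) (lam_gt0 : forall g, 0 < lam g)
    (A0 : R) (A0_gt1 : 1 < A0) :
  let xi := (A0 + 1) / (A0 - 1) in
  (forall (y : 'cV[R]_n) (betahat : forall g, 'cV[R]_(gsize dstar g)),
     is_gl_estimator U lam A0 y betahat ->
     forall fstar : 'cV[R]_n, noise_controlled U lam y fstar ->
     forall betabar : forall g, 'cV[R]_(gsize dstar g),
       let fhat := fit U betahat in
       let fbar := fit U betabar in
       (forall S : {set grp J0 J1 kmin kmax},
          ((norm2n (fhat - fstar) ^+ 2)%:E
             <= bound_B U lam A0 xi S + (bound_Delta U lam A0 fstar S betabar)%:E)%E
          /\
          ((norm2n (fhat - fbar) ^+ 2 + norm2n (fhat - fstar) ^+ 2)%:E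
             <= 4%:E * bound_B U lam A0 xi S
                + (2 * bound_Delta U lam A0 fstar S betabar)%:E)%E)
       /\
       (let S := [set g | A0 * lam g <= norm2n (U g *m betabar g)] in
        ((norm2n (fhat - fbar) ^+ 2 + norm2n (fhat - fstar) ^+ 2)%:E
           <= (2 * norm2n (fbar - fstar) ^+ 2)%:E
              + Cpred_star U lam A0 xi S
                * (\sum_g Num.min (lam g ^+ 2)
                                  (lam g * norm2n (U g *m betabar g)))%:E)%E))
  /\
  (forall (d : measure_display) (T : measurableType d) (P : probability T R)
     (fstar : 'cV[R]_n) (y : T -> 'cV[R]_n) (noise : 'I_n -> {RV P >-> R})
     (sigma eps : R),
     (forall omega i, (y omega - fstar) i 0 = noise i omega) ->
     0 < sigma -> iid_normal 0 sigma noise ->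
     0 < eps -> eps <= 1 -> 1 <= 2 * ln (p%:R / eps) ->
     (forall g, lam g = lambda_univ n dstar sigma eps g) ->
     ((1 - eps / Num.sqrt (2 * ln (p%:R / eps)))%:E
        <= P [set omega | noise_controlled U lam (y omega) fstar]%classic)%E).
Proof.
move=> xi; split.
  move=> y bh bh_min fstar ctrl b fhat fbar; split.
    by move=> S; exact: (oracle lam_gt0 b A0_gt1 bh_min ctrl).
  exact: (oracle_thresholded lam_gt0 A0_gt1 bh_min ctrl).
move=> d T P fstar y noise sigma eps noiseE sigma_gt0 iid eps_gt0 _ log_ge lamE.
exact: (noise_controlled_prob n_gt0 p_gt0 J01_disj k_le dstar_gt0 U noiseE sigma_gt0 iid).
Qed.
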